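(* Let $\mathcal F=\{F_1,\dots,F_\ell\}$ be a family of finitely many germs of biholomorphisms of $(\mathbb C^n,0)$ with linear parts $D_m$ at the origin, and let $\mathcal D=\{D_1,\dots,D_\ell\}$. Suppose that $\mathcal F$ is formally completely integrable. Then $\mathcal F$ is holomorphically completely integrable, provided the family $\mathcal D$ is of the Poincaré type. In particular, $\mathcal F$ is then holomorphically equivalent to a normal form in which each element commutes with $D_1,\dots,D_\ell$.
   Context: Standing assumptions: $D_m(z)=(\mu_{m1}z_1,\dots,\mu_{mn}z_n)$ is diagonal and invertible for each $m$, and changes of coordinates are tangent to the identity. The family $\mathcal F$ is formally (resp. holomorphically) completely integrable if there is a formal (resp. convergent) biholomorphic map $\Phi$, tangent to the identity at $0$, such that the maps $\hat F_m=\Phi^{-1}F_m\Phi$ satisfy: (i) $\hat F_m(z)=(\mu_{m1}(z)z_1,\dots,\mu_{mn}(z)z_n)$, where the $\mu_{mj}(z)$ are formal (resp. convergent) power series with $\mu_{mj}(0)=\mu_{mj}$ and $\mu_{mj}\circ D_{m'}=\mu_{mj}$ for $1\le m,m'\le\ell$, $1\le j\le n$; (ii) for each $j$ and each $Q\in\mathbb N^n$ with $|Q|>1$: $\mu_m^Q(0)=\mu_{mj}(0)$ holds for all $m$ if and only if $\mu_m^Q(z)=\mu_{mj}(z)$ holds for all $m$, where $\mu_m^Q(z)=\prod_k\mu_{mk}(z)^{q_k}$. Write $\mu_m^Q=\prod_k\mu_{mk}^{q_k}$. The family $\mathcal D$ is of the Poincaré type if there exist constants $d>1$ and $c>0$ such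 that for each $(j,Q)\in\{1,\dots,n\}\times\mathbb N^n$ for which $\mu_m^Q-\mu_{mj}\neq0$ for some $m$, there exists $(i,Q')\in\{1,\dots,\ell\}\times\mathbb N^n$ such that $\mu_k^{Q'}=\mu_k^Q$ for all $1\le k\le\ell$, $\mu_i^{Q'}-\mu_{ij}\ne0$, $\max(|\mu_i^{Q'}|,|\mu_i^{-Q'}|)>c^{-1}d^{|Q'|}$, and $Q'-Q\in\mathbb N^n\cup(-\mathbb N^n)$. *)

(* Defs.v *)
From HB Require Import structures.
From mathcomp Require Import all_boot all_order all_algebra.
From mathcomp Require Import reals complex mpoly.
(* Not imported: the notations of esum clash with those of multinomials. *)
From mathcomp Require classical_sets constructive_ereal esum.

Set Implicit Arguments.
Unset Strict Implicit.
Unset Printing Implicit Defensive.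

Import Order.TTheory GRing.Theory Num.Theory Normc.

Local Open Scope ring_scope.

(* A formal power series in n variables is its family of coefficients. *)
Definition series (R : realType) (n : nat) := 'X_{1..n} -> R[i].

(* Germs of holomorphic functions at 0 are identified with their Taylor
   series: the series that converge absolutely on some polydisc around 0. *)
Definition convergent (R : realType) (n : nat) (f : series R n) : Prop :=
  exists2 r : R, 0 < r &
    forall z : 'I_n -> R[i], (forall i, normc (z i) < r) ->
      esum.summable (@classical_sets.setT 'X_{1..n})
        (fun Q => constructive_ereal.EFin
                    (normc (f Q * \prod_(i < n) z i ^+ Q i))).

(* The sum of the terms of f of total degree at most N. *)
Definition trunc (R : realType) (n N : nat) (f : series R n) :
    {mpoly R[i][n]} :=
  \sum_(Q : 'X_{1..n < N.+1}) f Q *: 'X_[Q].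

(* The coefficient at Q of a product only involves the coefficients of degree
   at most |Q| of the factors, so it can be computed on truncations. *)
Definition series_mul (R : realType) (n : nat) (f g : series R n) :
    series R n :=
  fun Q => (trunc (mdeg Q) f * trunc (mdeg Q) g)@_Q.

(* f^Q = \prod_k f_k ^ (q_k). *)
Definition series_mpow (R : realType) (n : nat) (f : 'I_n -> series R n)
    (Q : 'X_{1..n}) : series R n :=
  fun P => (\prod_(k < n) trunc (mdeg P) (f k) ^+ Q k)@_P.

(* The variable z_j, that is, the j-th coordinate of the identity map. *)
Definition series_var (R : realType) (n : nat) (j : 'I_n) : series R n :=
  fun Q => (Q == U_(j)%MM)%:R.

(* f o G. This is the substitution of power series when G has no constant
   term, the only case in which it is used: then the coefficient of f o G at Q
   only involves the coefficients of degree at most |Q| of f and G. *)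
Definition series_comp (R : realType) (n : nat) (f : series R n)
    (G : 'I_n -> series R n) : series R n :=
  fun Q =>
    (trunc (mdeg Q) f \mPo [tuple trunc (mdeg Q) (G i) | i < n])@_Q.

(* Formal maps of (C^n, 0): the components are required to have no constant
   term by [fixes0]. *)
Definition smap (R : realType) (n : nat) := 'I_n -> series R n.

Definition fixes0 (R : realType) (n : nat) (F : smap R n) : Prop :=
  forall j, F j 0%MM = 0.

Definition smap_id (R : realType) (n : nat) : smap R n :=
  fun j => series_var R j.

Definition smap_comp (R : realType) (n : nat) (F G : smap R n) : smap R n :=
  fun j => series_comp (F j) G.

(* Jacobian matrix at 0: the entry (j, k) is the derivative of F_j along z_k. *)
Definition linear_part (R : realType) (n : nat) (F : smap R n) : 'M[R[i]]_n :=
  \matrix_(j, k) F j U_(k)%MM.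

Definition diag_smap (R : realType) (n : nat) (mu : 'rV[R[i]]_n) : smap R n :=
  fun j Q => mu 0 j * series_var R j Q.

(* The predicate [conv] selects the category in which one works: [formal] for
   formal maps, [convergent] for germs of holomorphic maps. *)
Definition formal (R : realType) (n : nat) (f : series R n) : Prop := True.

(* Phi is a biholomorphic map fixing 0 whose inverse is Psi. *)
Definition biholomorphic_pair (R : realType) (n : nat)
    (conv : series R n -> Prop) (Phi Psi : smap R n) : Prop :=
  [/\ fixes0 Phi /\ fixes0 Psi,
      forall j, conv (Phi j) /\ conv (Psi j),
      smap_comp Phi Psi = @smap_id R n &
      smap_comp Psi Phi = @smap_id R n].

Definition biholomorphic_germ (R : realType) (n : nat) (F : smap R n) : Prop :=
  exists G : smap R n, biholomorphic_pair (@convergent R n) F G.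

Definition tangent_to_id (R : realType) (n : nat) (Phi : smap R n) : Prop :=
  fixes0 Phi /\ linear_part Phi = 1%:M.

(* Phi^-1 F Phi, for Psi the inverse of Phi. *)
Definition conjugate (R : realType) (n : nat) (Phi Psi F : smap R n) :
    smap R n :=
  smap_comp Psi (smap_comp F Phi).

Definition completely_integrable (R : realType) (n l : nat)
    (conv : series R n -> Prop) (mu : 'M[R[i]]_(l, n))
    (F : 'I_l -> smap R n) : Prop :=
  exists Phi Psi : smap R n, exists nu : 'I_l -> 'I_n -> series R n,
  [/\ biholomorphic_pair conv Phi Psi /\ tangent_to_id Phi,
      (forall m j,
         conjugate Phi Psi (F m) j = series_mul (nu m j) (series_var R j)),
      (forall m j, conv (nu m j) /\ nu m j 0%MM = mu m j),
      (forall m m' j, series_comp (nu m j) (diag_smap (row m' mu)) = nu m j) &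
      (forall j (Q : 'X_{1..n}), (1 < mdeg Q)%N ->
         (forall m, series_mpow (nu m) Q 0%MM = nu m j 0%MM) <->
         (forall m, series_mpow (nu m) Q = nu m j))].

Definition formally_completely_integrable (R : realType) (n l : nat)
    (mu : 'M[R[i]]_(l, n)) (F : 'I_l -> smap R n) : Prop :=
  completely_integrable (@formal R n) mu F.

Definition holomorphically_completely_integrable (R : realType) (n l : nat)
    (mu : 'M[R[i]]_(l, n)) (F : 'I_l -> smap R n) : Prop :=
  completely_integrable (@convergent R n) mu F.

(* mu_m^Q = \prod_k mu_mk ^ (q_k). *)
Definition mu_pow (R : realType) (n l : nat) (mu : 'M[R[i]]_(l, n)) (m : 'I_l)
    (Q : 'X_{1..n}) : R[i] :=
  \prod_(k < n) mu m k ^+ Q k.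

(* The last conjunct says that Q' - Q or Q - Q' has natural entries. *)
Definition poincare_type (R : realType) (n l : nat) (mu : 'M[R[i]]_(l, n)) :
    Prop :=
  exists d c : R, [/\ 1 < d, 0 < c &
    forall (j : 'I_n) (Q : 'X_{1..n}),
      (exists m, mu_pow mu m Q - mu m j != 0) ->
      exists (i : 'I_l) (Q' : 'X_{1..n}),
        [/\ forall k, mu_pow mu k Q' = mu_pow mu k Q,
            mu_pow mu i Q' - mu i j != 0,
            Num.max (normc (mu_pow mu i Q')) (normc (mu_pow mu i Q')^-1)
              > c^-1 * d ^+ mdeg Q' &
            (forall k, (Q k <= Q' k)%N) \/ (forall k, (Q' k <= Q k)%N)]].

(* Conjugacy by one change of coordinates tangent to the identity, common to
   all the elements of the family. *)
Definition holomorphically_equivalent (R : realType) (n l : nat)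
    (F G : 'I_l -> smap R n) : Prop :=
  exists Phi Psi : smap R n,
  [/\ biholomorphic_pair (@convergent R n) Phi Psi, tangent_to_id Phi &
      forall m, G m = conjugate Phi Psi (F m)].

(* Main.v *)
(* Let [Phi] be a formal conjugacy to the normal form [nu_mj(z) z_j], and split
   [Phi] into resonant and nonresonant monomials.  The resonant part commutes
   with the [D_m]; composing [Phi] with its inverse keeps the normal form and
   reduces to the case where [phi = Phi - id] has no resonant monomial.
   With [f_m = F_m - D_m], the conjugacy equation then says that
   [(nu_mj - mu_mj) z_j] is the resonant part of [f_mj o Phi], and that
   [sum_Q (nu_m^Q(z) - mu_mj) phi_jQ z^Q] is its nonresonant part.  Condition
   (ii) gives [nu^P = 1] whenever [mu_m^P = 1] for all [m], so [nu_m^Q] is the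
   same series along a class of exponents that is stable under multiplication
   by invariant monomials and contains the [Q'] of the Poincare condition.  On
   each class one may thus divide by the single series [nu_i^Q' - mu_ij], and
   in a weighted l^1 norm of small radius this division is bounded uniformly.
   For a fixed small radius [r], an induction on the degree [N] of truncation
   shows that the norm of [phi] up to degree [N] is at most [r]. *)

(* The divisors [nu_i^Q' - mu_ij] are series whose convergence is not known beforehand, so every
   estimate concerns truncations and is uniform in the degree. The induction gains one degree
   because [f_m] has order two: [Phi] up to degree [N] determines [f_m o Phi] up to degree [N + 1].
   The gain in size has the same origin: if [phi] has norm at most [r], then [f_m o Phi] has norm at
   most [K r^2], with [K] independent of [r]. Dividing by [z_j] bounds [nu_m - mu_m] by [K r], which
   is small enough for the divisor estimate, and that estimate returns a bound of order [r^2] for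
   [phi], below [r] once [r] is small. The divisor estimate must tolerate a fixed error on [nu] for
   all [Q'] at once, although the relative error on [nu^Q'] may grow like [(1 + lam)^|Q'|]; the
   exponential growth in the Poincare condition absorbs this factor. The inverse [Psi] is bounded
   afterwards by the same bootstrap, applied to [Psi = id - phi o Psi]. *)
Require Import Defs.
From HB Require Import structures.
From mathcomp Require Import all_boot all_order all_algebra.
From mathcomp Require Import reals complex mpoly boolp ring lra zify.
From mathcomp Require Import -(notations) constructive_ereal.
From mathcomp Require ssrcomplements classical_sets esum fsbigop cardinality finmap ereal.

Set Implicit Arguments.
Unset Strict Implicit.
Unset Printing Implicit Defensive.

Import Order.TTheory GRing.Theory Num.Theory Normc.

Local Open Scope ring_scope.

(** * Polynomials modulo high degree, and their substitution *)

Section Congruence.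
Context (n : nat) (K : comNzRingType).
Implicit Types (p q a b : {mpoly K[n]}) (G H : 'I_n -> {mpoly K[n]}).
Implicit Types (Q : 'X_{1..n}).

Definition vanishing (s : nat) p := forall Q, (mdeg Q < s)%N -> p@_Q = 0.

Definition eqdeg (N : nat) p q :=
  forall Q, (mdeg Q <= N)%N -> p@_Q = q@_Q.

Definition subst G p := p \mPo [tuple G i | i < n].

Lemma eqdeg_refl N p : eqdeg N p p. Proof. by []. Qed.

Lemma eqdeg_sym N p q : eqdeg N p q -> eqdeg N q p.
Proof. by move=> e Q /e. Qed.

Lemma eqdeg_trans N p q a : eqdeg N p q -> eqdeg N q a -> eqdeg N p a.
Proof. by move=> e e' Q h; rewrite e ?e'. Qed.

Lemma eqdegD N p q a b : eqdeg N p q -> eqdeg N a b -> eqdeg N (p + a) (q + b).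
Proof. by move=> e e' Q h; rewrite !mcoeffD e ?e'. Qed.

Lemma eqdegN N p q : eqdeg N p q -> eqdeg N (- p) (- q).
Proof. by move=> e Q h; rewrite !mcoeffN e. Qed.

Lemma eqdegB N p q a b : eqdeg N p q -> eqdeg N a b -> eqdeg N (p - a) (q - b).
Proof. by move=> e e'; apply: eqdegD => //; apply: eqdegN. Qed.

Lemma eqdegP N p q : eqdeg N p q <-> vanishing N.+1 (p - q).
Proof.
split=> e Q h; first by rewrite mcoeffB e ?subrr.
by apply/eqP; rewrite -subr_eq0 -mcoeffB e.
Qed.

Lemma vanishing0 s : vanishing s 0.
Proof. by move=> Q _; rewrite mcoeff0. Qed.

Lemma vanishing_leq s t p : (s <= t)%N -> vanishing t p -> vanishing s p.
Proof. by move=> h v Q hQ; apply: v; apply: leq_trans h. Qed.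

Lemma vanishingD s p q : vanishing s p -> vanishing s q -> vanishing s (p + q).
Proof. by move=> e e' Q h; rewrite mcoeffD e ?e' ?addr0. Qed.

Lemma vanishing_sum s (I : Type) (r : seq I) (P : pred I) (f : I -> {mpoly K[n]}) :
  (forall i, P i -> vanishing s (f i)) -> vanishing s (\sum_(i <- r | P i) f i).
Proof.
by move=> h; apply: (big_ind (vanishing s)) => //;
  [exact: vanishing0 | move=> p q; exact: vanishingD].
Qed.

Lemma vanishingZ s c p : vanishing s p -> vanishing s (c *: p).
Proof. by move=> e Q h; rewrite mcoeffZ e ?mulr0. Qed.

Lemma vanishingM s t p q :
  vanishing s p -> vanishing t q -> vanishing (s + t) (p * q).
Proof.
move=> hp hq Q hQ; rewrite mcoeffM big1 // => -[k1 k2] /= /eqP eQ.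
have [h|h] := ltnP (mdeg k1) s; first by rewrite hp ?mul0r.
rewrite (hq k2) ?mulr0 //.
have : (mdeg k1 + mdeg k2 < s + t)%N by have := congr1 mdeg eQ; rewrite mdegD => <-.
lia.
Qed.

Lemma vanishingX s p k : vanishing s p -> vanishing (s * k) (p ^+ k).
Proof.
move=> hp; elim: k => [|k ih]; first by rewrite muln0.
by rewrite exprS mulnS; apply: vanishingM.
Qed.

Lemma vanishing_mon Q : vanishing (mdeg Q) ('X_[Q] : {mpoly K[n]}).
Proof. by move=> P h; rewrite mcoeffX; case: eqP h => // ->; rewrite ltnn. Qed.

(* Both factors have no constant term, which improves the congruence by one
   degree. *)
Lemma eqdegM1 N p q a b :
  vanishing 1 p -> vanishing 1 b -> eqdeg N p q -> eqdeg N a b ->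
  eqdeg N.+1 (p * a) (q * b).
Proof.
move=> hp hb /eqdegP e /eqdegP e'; apply/eqdegP.
have -> : p * a - q * b = p * (a - b) + (p - q) * b by ring.
apply: vanishingD; first by rewrite -[N.+2]add1n; apply: vanishingM.
by rewrite -[N.+2]addn1; apply: vanishingM.
Qed.

Lemma eqdegM N p q a b : eqdeg N p q -> eqdeg N a b -> eqdeg N (p * a) (q * b).
Proof.
move=> /eqdegP e /eqdegP e'; apply/eqdegP.
have -> : p * a - q * b = p * (a - b) + (p - q) * b by ring.
apply: vanishingD; first by rewrite -[N.+1]add0n; apply: vanishingM.
by rewrite -[N.+1]addn0; apply: vanishingM.
Qed.

Lemma eqdegX N p q k : eqdeg N p q -> eqdeg N (p ^+ k) (q ^+ k).
Proof.
move=> e; elim: k => [|k ih]; first exact: eqdeg_refl.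
by rewrite !exprS; apply: eqdegM.
Qed.

Lemma eqdeg_prod N (I : Type) (r : seq I) (P : pred I) (f g : I -> {mpoly K[n]}) :
  (forall i, P i -> eqdeg N (f i) (g i)) ->
  eqdeg N (\prod_(i <- r | P i) f i) (\prod_(i <- r | P i) g i).
Proof.
by move=> h; apply: (big_ind2 (eqdeg N)) => // *; apply: eqdegM.
Qed.

Lemma eqdeg_sum N (I : Type) (r : seq I) (P : pred I) (f g : I -> {mpoly K[n]}) :
  (forall i, P i -> eqdeg N (f i) (g i)) ->
  eqdeg N (\sum_(i <- r | P i) f i) (\sum_(i <- r | P i) g i).
Proof.
by move=> h; apply: (big_ind2 (eqdeg N)) => // *; apply: eqdegD.
Qed.

Lemma eqdegZ N c p q : eqdeg N p q -> eqdeg N (c *: p) (c *: q).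
Proof. by move=> e Q h; rewrite !mcoeffZ e. Qed.

Lemma substXm G Q : subst G 'X_[Q] = \prod_(i < n) G i ^+ Q i.
Proof.
by rewrite /subst comp_mpolyX; apply: eq_bigr => i _; rewrite tnth_mktuple.
Qed.

Lemma substX G i : subst G 'X_i = G i.
Proof. by rewrite /subst comp_mpolyXU -tnth_nth tnth_mktuple. Qed.

Lemma substE G p : subst G p = \sum_(Q <- msupp p) p@_Q *: subst G 'X_[Q].
Proof. exact: comp_mpolyEX. Qed.

Lemma substD G : {morph subst G : p q / p + q}.
Proof. exact: raddfD. Qed.

Lemma substB G : {morph subst G : p q / p - q}.
Proof. exact: raddfB. Qed.

Lemma substM G : {morph subst G : p q / p * q}.
Proof. by move=> p q; rewrite /subst rmorphM. Qed.

Lemma subst_sum G (I : Type) (r : seq I) (P : pred I) (f : I -> {mpoly K[n]}) :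
  subst G (\sum_(i <- r | P i) f i) = \sum_(i <- r | P i) subst G (f i).
Proof. exact: raddf_sum. Qed.

Lemma substZ G c p : subst G (c *: p) = c *: subst G p.
Proof. exact: comp_mpolyZ. Qed.

Lemma subst_id p : subst (fun i => 'X_i) p = p.
Proof. exact: comp_mpoly_id. Qed.

Lemma substA G H p : subst H (subst G p) = subst (fun i => subst H (G i)) p.
Proof.
rewrite (substE G) [RHS]substE subst_sum; apply: eq_bigr => Q _.
rewrite substZ !substXm; congr (_ *: _); rewrite /subst rmorph_prod.
by apply: eq_bigr => i _; rewrite rmorphXn.
Qed.

Lemma vanishing_substX G Q :
  (forall i, vanishing 1 (G i)) -> vanishing (mdeg Q) (subst G 'X_[Q]).
Proof.
move=> hG; rewrite substXm mdegE.
apply: (big_ind2 (fun s p => vanishing s p)) => //.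
  by move=> s p t q; apply: vanishingM.
by move=> i _; have := @vanishingX 1 (G i) (Q i) (hG i); rewrite mul1n.
Qed.

Lemma vanishing_subst s G p :
  (forall i, vanishing 1 (G i)) -> vanishing s p -> vanishing s (subst G p).
Proof.
move=> hG hp; rewrite substE big_seq; apply: vanishing_sum => Q.
have [h|h _] := ltnP (mdeg Q) s.
  by move=> _; rewrite hp // scale0r; apply: vanishing0.
by apply: vanishingZ; apply: vanishing_leq h _; apply: vanishing_substX.
Qed.

Lemma eqdeg_subst_in N G H p :
  (forall i, eqdeg N (G i) (H i)) -> eqdeg N (subst G p) (subst H p).
Proof.
move=> e; rewrite !(substE _ p); apply: eqdeg_sum => Q _; apply: eqdegZ.
by rewrite !substXm; apply: eqdeg_prod => i _; apply: eqdegX.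
Qed.

Lemma eqdeg_subst N G H p q :
  (forall i, vanishing 1 (G i)) -> eqdeg N p q ->
  (forall i, eqdeg N (G i) (H i)) -> eqdeg N (subst G p) (subst H q).
Proof.
move=> hG e e'; apply: (@eqdeg_trans _ _ (subst G q)); last exact: eqdeg_subst_in.
by apply/eqdegP; rewrite -substB; apply: vanishing_subst => //; apply/eqdegP.
Qed.

Lemma mnm_split Q : Q != 0%MM -> exists i, Q = (U_(i) + (Q - U_(i)))%MM.
Proof.
move=> h; have [i hi] : exists i, Q i != 0%N.
  apply/existsP; apply: contraNT h; rewrite negb_exists => /forallP h.
  by apply/eqP/mnmP => i; rewrite mnm0E; apply/eqP; have := h i; rewrite negbK.
by exists i; rewrite addmC submK // lep1mP.
Qed.

(** A monomial of degree at least two is some [z_i] times a nonconstant monomial, so [eqdegM1] gains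
    one degree. This gain drives both the formal inverse and the inductions on the degree in the
    convergence proof. *)
Lemma eqdeg_subst2 N G H p :
  (forall i, vanishing 1 (G i)) -> (forall i, vanishing 1 (H i)) ->
  (forall i, eqdeg N (G i) (H i)) -> vanishing 2 p ->
  eqdeg N.+1 (subst G p) (subst H p).
Proof.
move=> hG hH e hp; rewrite !(substE _ p); apply: eqdeg_sum => Q _.
have [h|h] := ltnP (mdeg Q) 2.
  by rewrite (hp _ h) (scale0r (subst G _)) (scale0r (subst H _)).
have [|i eQ] := @mnm_split Q.
  by apply: contraTneq h => ->; rewrite mdeg0.
have hR : (0 < mdeg (Q - U_(i)))%N.
  by move: h; rewrite {1}eQ mdegD mdeg1.
apply: eqdegZ; rewrite eQ mpolyXD !substM; apply: eqdegM1.
- by rewrite substX.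
- by apply: vanishing_leq hR _; apply: vanishing_substX.
- by rewrite !substX.
- exact: eqdeg_subst_in.
Qed.

End Congruence.

(* Locking keeps unification from unfolding the truncated polynomials when two
   series are compared. *)
Fact series_key : unit. Proof. exact: tt. Qed.

Definition tr (R : realType) n := locked_with series_key (@trunc R n).
Definition smul (R : realType) n := locked_with series_key (@series_mul R n).
Definition smpow (R : realType) n := locked_with series_key (@series_mpow R n).
Definition scomp (R : realType) n := locked_with series_key (@series_comp R n).
Definition ssub (R : realType) n : series R n -> series R n -> series R n :=
  locked_with series_key (fun f g Q => f Q - g Q).
Definition cmap (R : realType) n (F G : smap R n) : smap R n :=
  fun j => scomp (F j) G.

(** * Algebra and composition of formal series, through truncations *)

Section FormalSeries.
Context (R : realType) (n : nat).
Implicit Types (f g : series R n) (F G H : smap R n) (Q P : 'X_{1..n}).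

Lemma truncE N f : tr N f = \sum_(Q : 'X_{1..n < N.+1}) f Q *: 'X_[Q].
Proof. by rewrite /tr locked_withE. Qed.

Lemma ssubE f g Q : ssub f g Q = f Q - g Q.
Proof. by rewrite /ssub locked_withE. Qed.

Lemma smulE f g Q : smul f g Q = (tr (mdeg Q) f * tr (mdeg Q) g)@_Q.
Proof. by rewrite /smul /tr !locked_withE. Qed.

Lemma smpowE G Q P : smpow G Q P = (\prod_(k < n) tr (mdeg P) (G k) ^+ Q k)@_P.
Proof. by rewrite /smpow /tr !locked_withE. Qed.

Lemma scompE f G Q :
  scomp f G Q = (subst (fun i => tr (mdeg Q) (G i)) (tr (mdeg Q) f))@_Q.
Proof. by rewrite /scomp /tr !locked_withE. Qed.

Lemma cmapE F G j : cmap F G j = scomp (F j) G.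
Proof. by []. Qed.

Lemma mcoeff_trunc N f Q : (tr N f)@_Q = if (mdeg Q <= N)%N then f Q else 0.
Proof.
rewrite truncE; case: leqP => h.
  by rewrite (mcoeff_mpoly (fun Q => f Q)).
rewrite raddf_sum big1 // => -[P hP] _ /=; rewrite mcoeffZ mcoeffX.
by case: eqP => [e|]; rewrite ?mulr0 //; move: hP h; rewrite e; lia.
Qed.

Lemma trunc_eqdeg M N f : (M <= N)%N -> eqdeg M (tr N f) (tr M f).
Proof.
by move=> h Q hQ; rewrite !mcoeff_trunc hQ (leq_trans hQ h).
Qed.

Lemma eqdeg_trunc N f p :
  eqdeg N (tr N f) p <-> forall Q, (mdeg Q <= N)%N -> f Q = p@_Q.
Proof.
by split=> e Q h; have := e Q h; rewrite mcoeff_trunc h.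
Qed.

Lemma series_eqP f g : (forall N, eqdeg N (tr N f) (tr N g)) -> f = g.
Proof.
move=> e; apply: funext => Q; have := e (mdeg Q) Q (leqnn _).
by rewrite !mcoeff_trunc leqnn.
Qed.

Lemma truncB N f g : tr N (ssub f g) = tr N f - tr N g.
Proof.
apply/mpolyP => Q; rewrite mcoeffB !mcoeff_trunc ssubE; case: leqP => //.
by rewrite subr0.
Qed.

Lemma truncZ N c f : tr N (fun Q => c * f Q) = c *: tr N f.
Proof.
by apply/mpolyP => Q; rewrite mcoeffZ !mcoeff_trunc; case: leqP; rewrite ?mulr0.
Qed.

Lemma vanishing1_trunc N f : f 0%MM = 0 -> vanishing 1 (tr N f).
Proof.
move=> f0 Q; rewrite ltnS leqn0 mdeg_eq0 => /eqP ->.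
by rewrite mcoeff_trunc mdeg0 f0.
Qed.

Lemma trunc_var N (j : 'I_n) : eqdeg N (tr N (series_var R j)) 'X_j.
Proof. by move=> Q h; rewrite mcoeff_trunc h mcoeffX eq_sym. Qed.

Lemma trunc_mul N f g :
  eqdeg N (tr N (smul f g)) (tr N f * tr N g).
Proof.
apply/eqdeg_trunc => Q h; rewrite smulE.
by apply: eqdegM (leqnn _); apply: eqdeg_sym; apply: trunc_eqdeg.
Qed.

Lemma trunc_mpow N G Q :
  eqdeg N (tr N (smpow G Q)) (\prod_(k < n) tr N (G k) ^+ Q k).
Proof.
apply/eqdeg_trunc => P h; rewrite smpowE.
apply: eqdeg_prod (leqnn _) => k _; apply: eqdegX.
by apply: eqdeg_sym; apply: trunc_eqdeg.
Qed.

Lemma trunc_comp N f G : fixes0 G ->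
  eqdeg N (tr N (scomp f G)) (subst (fun i => tr N (G i)) (tr N f)).
Proof.
move=> G0; apply/eqdeg_trunc => Q h; rewrite scompE.
apply: (@eqdeg_subst _ _ (mdeg Q)) (leqnn _) => [i||i].
- exact: vanishing1_trunc.
- by apply: eqdeg_sym; apply: trunc_eqdeg.
- by apply: eqdeg_sym; apply: trunc_eqdeg.
Qed.

Lemma vanishing1_comp N f G : f 0%MM = 0 -> fixes0 G ->
  vanishing 1 (tr N (scomp f G)).
Proof.
move=> f0 G0; apply: vanishing1_trunc; rewrite scompE.
apply: (@vanishing_subst _ _ 1) => [i||]; last by rewrite mdeg0.
- exact: vanishing1_trunc.
- exact: vanishing1_trunc.
Qed.

Lemma fixes0_comp F G : fixes0 F -> fixes0 G -> fixes0 (cmap F G).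
Proof.
move=> F0 G0 j; have := @vanishing1_comp 0 (F j) G (F0 j) G0 0%MM.
by rewrite mcoeff_trunc mdeg0 => h; apply: h.
Qed.

Lemma series_var0 (j : 'I_n) : series_var R j 0%MM = 0.
Proof. by rewrite /series_var eq_sym mnm1_eq0. Qed.

Lemma fixes0_id : fixes0 (@smap_id R n).
Proof. by move=> j; apply: series_var0. Qed.

Lemma series_compA f G H : fixes0 G -> fixes0 H ->
  scomp (scomp f G) H = scomp f (cmap G H).
Proof.
move=> G0 H0; apply: series_eqP => N.
apply: eqdeg_trans (trunc_comp _ H0) _.
apply: eqdeg_sym; apply: eqdeg_trans (trunc_comp _ (fixes0_comp G0 H0)) _.
have h1 i : vanishing 1 (tr N (H i)) by apply: vanishing1_trunc.
apply: (@eqdeg_trans _ _ _ _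
  (subst (fun i => tr N (H i)) (subst (fun i => tr N (G i)) (tr N f)))).
  rewrite substA; apply: eqdeg_subst_in => i; exact: trunc_comp.
apply: eqdeg_subst => // ; exact: (eqdeg_sym (trunc_comp _ G0)).
Qed.

Lemma smap_compA F G H : fixes0 G -> fixes0 H ->
  cmap (cmap F G) H = cmap F (cmap G H).
Proof. by move=> G0 H0; apply: funext => j; apply: series_compA. Qed.

Lemma series_comp_id f : scomp f (@smap_id R n) = f.
Proof.
apply: series_eqP => N; apply: eqdeg_trans (trunc_comp _ fixes0_id) _.
rewrite -[X in eqdeg _ _ X]subst_id; apply: eqdeg_subst_in => i.
exact: trunc_var.
Qed.

Lemma smap_comp_id F : cmap F (@smap_id R n) = F.
Proof. by apply: funext => j; apply: series_comp_id. Qed.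

Lemma series_var_comp (j : 'I_n) G : fixes0 G -> scomp (series_var R j) G = G j.
Proof.
move=> G0; apply: series_eqP => N; apply: eqdeg_trans (trunc_comp _ G0) _.
rewrite -[X in eqdeg _ _ X](substX (fun i => tr N (G i))).
apply: eqdeg_subst => [i||i]; [exact: vanishing1_trunc|exact: trunc_var|by []].
Qed.

Lemma smap_id_comp G : fixes0 G -> cmap (@smap_id R n) G = G.
Proof. by move=> G0; apply: funext => j; apply: series_var_comp. Qed.

Lemma series_mul_comp f g G : fixes0 G ->
  scomp (smul f g) G = smul (scomp f G) (scomp g G).
Proof.
move=> G0; apply: series_eqP => N; apply: eqdeg_trans (trunc_comp _ G0) _.
apply: eqdeg_sym; apply: eqdeg_trans (trunc_mul _ _) _.
apply: (@eqdeg_trans _ _ _ _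
  (subst (fun i => tr N (G i)) (tr N f * tr N g))).
  by rewrite substM; apply: eqdegM; apply: trunc_comp.
apply: eqdeg_subst => [i||//]; first exact: vanishing1_trunc.
exact: eqdeg_sym (trunc_mul _ _).
Qed.

Lemma series_mpow_comp (nu : 'I_n -> series R n) Q G : fixes0 G ->
  scomp (smpow nu Q) G = smpow (fun k => scomp (nu k) G) Q.
Proof.
move=> G0; apply: series_eqP => N; apply: eqdeg_trans (trunc_comp _ G0) _.
apply: eqdeg_sym; apply: eqdeg_trans (trunc_mpow _ _) _.
apply: (@eqdeg_trans _ _ _ _
  (subst (fun i => tr N (G i)) (\prod_(k < n) tr N (nu k) ^+ Q k))).
  rewrite /subst rmorph_prod; apply: eqdeg_prod => k _; rewrite rmorphXn.
  by apply: eqdegX; apply: trunc_comp.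
apply: eqdeg_subst => [i||//]; first exact: vanishing1_trunc.
exact: eqdeg_sym (trunc_mpow _ _).
Qed.

Lemma series_comp0 f G : fixes0 G -> scomp f G 0%MM = f 0%MM.
Proof.
move=> G0; have /(_ 0%MM) := @trunc_comp 0 f G G0.
rewrite mcoeff_trunc mdeg0 leqnn => -> //.
have e : eqdeg 0 (tr 0 f) (f 0%MM)%:MP.
  move=> Q; rewrite leqn0 mdeg_eq0 => /eqP ->.
  by rewrite mcoeff_trunc mdeg0 mcoeffC eqxx mulr1.
rewrite (@eqdeg_subst _ _ 0 _ (fun i => tr 0 (G i)) _ (f 0%MM)%:MP) ?mdeg0 //.
  by rewrite /subst comp_mpolyC mcoeffC eqxx mulr1.
by move=> i; apply: vanishing1_trunc.
Qed.

Lemma series_mpow0 (nu : 'I_n -> series R n) Q :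
  smpow nu Q 0%MM = \prod_(k < n) nu k 0%MM ^+ Q k.
Proof.
rewrite smpowE mdeg0.
have e : eqdeg 0 (\prod_(k < n) tr 0 (nu k) ^+ Q k)
    (\prod_(k < n) ((nu k 0%MM)%:MP : {mpoly R[i][n]}) ^+ Q k).
  apply: eqdeg_prod => k _; apply: eqdegX => P.
  rewrite leqn0 mdeg_eq0 => /eqP ->.
  by rewrite mcoeff_trunc mdeg0 mcoeffC eqxx mulr1.
rewrite e ?mdeg0 //.
under eq_bigr do rewrite -rmorphXn; rewrite -rmorph_prod.
by rewrite mcoeffC eqxx mulr1.
Qed.

Lemma tangentP F :
  tangent_to_id F <-> forall j Q, (mdeg Q < 2)%N -> F j Q = series_var R j Q.
Proof.
split=> [[F0 /matrixP FL] j Q|h].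
  case e: (mdeg Q) => [|[|//]] _.
    by move/eqP: e; rewrite mdeg_eq0 => /eqP ->; rewrite F0 series_var0.
  move/eqP: e => /mdeg1P[k /eqP ->]; have := FL j k; rewrite !mxE => ->.
  by rewrite /series_var eq_mnm1 eq_sym.
split=> [j|]; first by rewrite h ?mdeg0 // series_var0.
apply/matrixP => j k; rewrite !mxE h ?mdeg1 //.
by rewrite /series_var eq_mnm1 eq_sym.
Qed.

Lemma tangent_eqdeg F (j : 'I_n) : tangent_to_id F -> eqdeg 1 (tr 1 (F j)) 'X_j.
Proof.
move=> /tangentP h Q hQ; rewrite mcoeff_trunc hQ h // /series_var mcoeffX.
by rewrite eq_sym.
Qed.

Lemma tangent_comp F G :
  tangent_to_id F -> tangent_to_id G -> tangent_to_id (cmap F G).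
Proof.
move=> tF tG; have [G0 _] := tG; apply/tangentP => j Q hQ.
have hv i : vanishing 1 (tr 1 (G i)) by apply: vanishing1_trunc.
have /(_ Q hQ) := @trunc_comp 1 (F j) G G0.
rewrite mcoeff_trunc -ltnS hQ => e; rewrite [LHS]e.
have e2 : eqdeg 1 (subst (fun i => tr 1 (G i)) (tr 1 (F j)))
    (subst (fun i => 'X_i) 'X_j).
  apply: eqdeg_subst => [//||i]; exact: tangent_eqdeg.
by rewrite [LHS](e2 Q hQ) subst_id mcoeffX eq_sym.
Qed.

End FormalSeries.

(** * Formal inverse of a map tangent to the identity *)

Section FormalInverse.
Context (R : realType) (n : nat).
Implicit Types (F G T : smap R n).

(** A right inverse [T] of [F] is a fixed point of this map, since [F o T = id] reads
    [T = id - (F - id) o T]; it is reached by iteration from the identity. *)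
Definition inverse_step F G : smap R n :=
  fun j => ssub (series_var R j)
    (scomp (ssub (F j) (series_var R j)) G).

Definition inverse_approx F k : smap R n := iter k (inverse_step F) (@smap_id R n).

(** A coefficient of degree [k] no longer changes after the [k]-th iterate, so it is read off
    there. *)
Definition formal_inverse F : smap R n := fun j Q => inverse_approx F (mdeg Q) j Q.

Lemma order2_tangent F N j : tangent_to_id F ->
  vanishing 2 (tr N (ssub (F j) (series_var R j))).
Proof.
move=> /tangentP h Q hQ; rewrite mcoeff_trunc; case: leqP => // _.
by rewrite ssubE h // subrr.
Qed.

Lemma inverse_step_fixes0 F G :
  tangent_to_id F -> fixes0 G -> fixes0 (inverse_step F G).
Proof.
move=> tF G0 j; rewrite /inverse_step ssubE series_var0 sub0r series_comp0 //.
by move/tangentP: tF => h; rewrite ssubE h ?mdeg0 // subrr oppr0.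
Qed.

Lemma inverse_approx_fixes0 F k : tangent_to_id F -> fixes0 (inverse_approx F k).
Proof.
move=> tF; elim: k => [|k ih]; first exact: fixes0_id.
exact: inverse_step_fixes0.
Qed.

(** Contraction with respect to the degree: [F - id] has order two, so each iteration makes one more
    degree agree. *)
Lemma inverse_step_eqdeg F G H N j : tangent_to_id F -> fixes0 G -> fixes0 H ->
  (forall i, eqdeg N (tr N (G i)) (tr N (H i))) ->
  eqdeg N.+1 (tr N.+1 (inverse_step F G j)) (tr N.+1 (inverse_step F H j)).
Proof.
move=> tF G0 H0 e; rewrite /inverse_step !truncB.
apply: eqdegB; first exact: eqdeg_refl.
apply: eqdeg_trans (trunc_comp _ G0) _; apply: eqdeg_sym.
apply: eqdeg_trans (trunc_comp _ H0) _; apply: eqdeg_sym.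
apply: eqdeg_subst2 => [i|i|i|].
- exact: vanishing1_trunc.
- exact: vanishing1_trunc.
- apply: eqdeg_trans (trunc_eqdeg _ (leqnSn _)) _; apply: eqdeg_sym.
  by apply: eqdeg_trans (trunc_eqdeg _ (leqnSn _)) _; apply: eqdeg_sym.
- exact: order2_tangent.
Qed.

Lemma inverse_approx_step F k j : tangent_to_id F ->
  eqdeg k.+1 (tr k.+1 (inverse_approx F k.+1 j))
             (tr k.+1 (inverse_approx F k j)).
Proof.
move=> tF; elim: k j => [|k ih] j; last first.
  by apply: (inverse_step_eqdeg _ tF) (ih); apply: inverse_approx_fixes0.
apply/eqdeg_trunc => Q hQ; rewrite mcoeff_trunc hQ /inverse_approx /=.
rewrite /inverse_step ssubE series_comp_id.
by move/tangentP: tF => h; rewrite ssubE h // subrr subr0.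
Qed.

Lemma inverse_approx_stable F k j Q : tangent_to_id F -> (mdeg Q <= k)%N ->
  inverse_approx F k j Q = formal_inverse F j Q.
Proof.
move=> tF hk; rewrite /formal_inverse -(subnK hk).
elim: (k - mdeg Q)%N => // d ih; rewrite addSn -ih.
have /(_ Q) := @inverse_approx_step F (d + mdeg Q) j tF.
rewrite !mcoeff_trunc; have -> : (mdeg Q <= (d + mdeg Q).+1)%N by lia.
by apply.
Qed.

Lemma formal_inverse_fixes0 F : tangent_to_id F -> fixes0 (formal_inverse F).
Proof. by move=> tF j; apply: inverse_approx_fixes0. Qed.

Lemma formal_inverse_eq F : tangent_to_id F ->
  formal_inverse F = inverse_step F (formal_inverse F).
Proof.
move=> tF; apply: funext => j; apply: funext => Q.
have hQ : (mdeg Q <= (mdeg Q).+1)%N by [].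
rewrite -(inverse_approx_stable _ tF hQ).
have /(_ Q hQ) : eqdeg (mdeg Q).+1
    (tr (mdeg Q).+1 (inverse_step F (inverse_approx F (mdeg Q)) j))
    (tr (mdeg Q).+1 (inverse_step F (formal_inverse F) j)).
  apply: inverse_step_eqdeg => // [||i P hP].
  - exact: inverse_approx_fixes0.
  - exact: formal_inverse_fixes0.
  - by rewrite !mcoeff_trunc hP (inverse_approx_stable _ tF hP).
by move=> e; rewrite !mcoeff_trunc hQ in e; exact: e.
Qed.

Lemma formal_inverse_tangent F : tangent_to_id F -> tangent_to_id (formal_inverse F).
Proof.
move=> tF; apply/tangentP => j Q hQ.
rewrite formal_inverse_eq // /inverse_step ssubE.
have /(_ Q) := @trunc_comp R n 1 (ssub (F j) (series_var R j)) _
  (formal_inverse_fixes0 tF).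
rewrite mcoeff_trunc -ltnS hQ => -> //.
rewrite (@vanishing_subst _ _ 2) ?subr0 //; last exact: order2_tangent.
by move=> i; apply: vanishing1_trunc; apply: formal_inverse_fixes0.
Qed.

Lemma formal_inverseVr F : tangent_to_id F ->
  cmap F (formal_inverse F) = @smap_id R n.
Proof.
move=> tF; have T0 := formal_inverse_fixes0 tF.
apply: funext => j; apply: series_eqP => N.
apply: eqdeg_trans (trunc_comp _ T0) _.
have e : tr N (F j) = tr N (series_var R j) +
    tr N (ssub (F j) (series_var R j)).
  by rewrite truncB addrC subrK.
rewrite e substD.
apply: (@eqdeg_trans _ _ _ _ (tr N (formal_inverse F j) +
  tr N (scomp (ssub (F j) (series_var R j)) (formal_inverse F)))).
  apply: eqdegD; last exact: eqdeg_sym (trunc_comp _ T0).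
  apply: eqdeg_trans (eqdeg_sym (trunc_comp _ T0)) _.
  by rewrite series_var_comp.
rewrite {1}(formal_inverse_eq tF) /inverse_step truncB subrK.
exact: eqdeg_refl.
Qed.

(** The right inverse [T] has itself a right inverse [S], and
    [F = F o (T o S) = (F o T) o S = S]. *)
Lemma formal_inverseVl F : tangent_to_id F ->
  cmap (formal_inverse F) F = @smap_id R n.
Proof.
move=> tF; set T := formal_inverse F; have tT := formal_inverse_tangent tF.
have e := formal_inverseVr tT; set S := formal_inverse T in e.
have [F0 _] := tF; have [T0 _] := tT.
have S0 : fixes0 S by apply: formal_inverse_fixes0.
have -> : F = S; last exact: e.
by rewrite -[F]smap_comp_id -e -smap_compA // formal_inverseVr // smap_id_comp.
Qed.

Lemma inverse_commute F T D : fixes0 F -> fixes0 T -> fixes0 D ->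
  cmap F T = @smap_id R n -> cmap T F = @smap_id R n ->
  cmap F D = cmap D F -> cmap T D = cmap D T.
Proof.
move=> F0 T0 D0 e e' c.
rewrite -[LHS]smap_comp_id -e smap_compA //; last exact: fixes0_comp.
rewrite -(smap_compA D) // -c (smap_compA F) // -(smap_compA T) //.
  by rewrite e' smap_id_comp //; apply: fixes0_comp.
exact: fixes0_comp.
Qed.

End FormalInverse.

(** * Weights of monomials under the diagonal maps, and resonance *)

Section Weights.
Context (R : realType) (n l : nat) (mu : 'M[R[i]]_(l, n)).
Implicit Types (f : series R n) (F G : smap R n) (p q : {mpoly R[i][n]}).
Implicit Types (chi : 'I_l -> R[i]) (Q P : 'X_{1..n}).

Lemma mu_powD m Q P : mu_pow mu m (Q + P)%MM = mu_pow mu m Q * mu_pow mu m P.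
Proof.
by rewrite /mu_pow -big_split; apply: eq_bigr => k _; rewrite mnmDE exprD.
Qed.

Lemma mu_pow0 m : mu_pow mu m 0%MM = 1.
Proof. by rewrite /mu_pow big1 // => k _; rewrite mnm0E expr0. Qed.

Lemma mu_powU m k : mu_pow mu m U_(k)%MM = mu m k.
Proof.
rewrite /mu_pow (bigD1 k) //= mnm1E eqxx expr1 big1 ?mulr1 // => i hi.
by rewrite mnm1E eq_sym (negbTE hi) expr0.
Qed.

(** Unless it is zero, such a [p] is a common eigenvector of the substitutions of the [D_m], with
    eigenvalues [chi m]. *)
Definition weighted chi p := forall Q, p@_Q != 0 -> forall m, mu_pow mu m Q = chi m.

Lemma weighted_eq chi chi' p : chi =1 chi' -> weighted chi p -> weighted chi' p.
Proof. by move=> e w Q h m; rewrite -e w. Qed.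

Lemma weighted1 : weighted (fun=> 1) 1.
Proof.
move=> Q; rewrite mcoeff1; have [-> _ m|_] := eqVneq Q 0%MM; last by rewrite eqxx.
exact: mu_pow0.
Qed.

Lemma weightedM chi chi' p q : weighted chi p -> weighted chi' q ->
  weighted (fun m => chi m * chi' m) (p * q).
Proof.
move=> wp wq Q; rewrite mcoeffM => h m.
have [[k1 k2] /= /eqP eQ hk] : exists2 k : 'X_{1..n < (mdeg Q).+1, (mdeg Q).+1},
    Q == (k.1 + k.2)%MM & p@_k.1 * q@_k.2 != 0.
  apply: contra_neqP h => /forall2NP h; apply: big1 => k hk.
  by case: (h k) => // /negP; rewrite negbK => /eqP.
move: hk; rewrite mulf_eq0 negb_or => /andP[h1 h2].
by rewrite [in LHS]eQ mu_powD wp ?wq.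
Qed.

Lemma weighted_prod (I : Type) (r : seq I) (chi : I -> 'I_l -> R[i])
    (f : I -> {mpoly R[i][n]}) :
  (forall i, weighted (chi i) (f i)) ->
  weighted (fun m => \prod_(i <- r) chi i m) (\prod_(i <- r) f i).
Proof.
move=> h; elim: r => [|i r ih].
  by rewrite big_nil; apply: weighted_eq weighted1 => m; rewrite big_nil.
rewrite big_cons; apply: weighted_eq (weightedM (h i) ih) => m.
by rewrite big_cons.
Qed.

Lemma weightedX chi p k : weighted chi p ->
  weighted (fun m => chi m ^+ k) (p ^+ k).
Proof.
move=> w; elim: k => [|k ih]; first by rewrite expr0; apply: weighted1.
rewrite exprS; apply: weighted_eq (weightedM w ih) => m.
by rewrite exprS.
Qed.

Lemma weighted_substX (G : 'I_n -> {mpoly R[i][n]}) Q :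
  (forall k, weighted (fun m => mu m k) (G k)) ->
  weighted (fun m => mu_pow mu m Q) (subst G 'X_[Q]).
Proof.
by move=> w; rewrite substXm; apply: weighted_prod => k; apply: weightedX.
Qed.

Lemma weights_subst (G : 'I_n -> {mpoly R[i][n]}) p P :
  (forall k, weighted (fun m => mu m k) (G k)) -> (subst G p)@_P != 0 ->
  exists2 Q, p@_Q != 0 & forall m, mu_pow mu m P = mu_pow mu m Q.
Proof.
move=> w; rewrite substE raddf_sum => /= h.
have [Q hQ] : exists Q, (p@_Q *: subst G 'X_[Q])@_P != 0.
  apply: contra_neqP h => /forallNP h; rewrite big1 // => Q _.
  by have /negP := h Q; rewrite negbK => /eqP.
move: hQ; rewrite mcoeffZ mulf_eq0 negb_or => /andP[h1 h2].
by exists Q => // m; apply: weighted_substX h2 m.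
Qed.

Lemma diag_fixes0 (a : 'rV[R[i]]_n) : fixes0 (diag_smap a).
Proof. by move=> j; rewrite /diag_smap series_var0 mulr0. Qed.

Lemma comp_diag f m Q :
  scomp f (diag_smap (row m mu)) Q = f Q * mu_pow mu m Q.
Proof.
have /(_ Q (leqnn _)) := @trunc_comp R n (mdeg Q) f _ (diag_fixes0 (row m mu)).
rewrite mcoeff_trunc leqnn => ->.
have /(_ Q (leqnn _)) -> : eqdeg (mdeg Q)
    (subst (fun i => tr (mdeg Q) (diag_smap (row m mu) i)) (tr (mdeg Q) f))
    (subst (fun i => mu m i *: 'X_i) (tr (mdeg Q) f)).
  apply: eqdeg_subst_in => i; rewrite truncZ mxE; apply: eqdegZ.
  exact: trunc_var.
rewrite truncE subst_sum raddf_sum /=.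
have e P : (subst (fun i => mu m i *: 'X_i) 'X_[P] : {mpoly R[i][n]}) =
    mu_pow mu m P *: 'X_[P].
  rewrite substXm; under eq_bigr do rewrite exprZn.
  by rewrite scaler_prod -[X in _ *: X]substXm subst_id.
have hQ : (mdeg Q < (mdeg Q).+1)%N by [].
rewrite (bigD1 (BMultinom hQ)) //= substZ e mcoeffZ mcoeffZ mcoeffX eqxx mulr1.
rewrite big1 ?addr0 // => P hP.
rewrite substZ e !mcoeffZ mcoeffX; case: eqP => [eP|]; last by rewrite !mulr0.
by case/eqP: hP; apply: val_inj.
Qed.

Lemma diag_comp (a : 'rV[R[i]]_n) F j Q : fixes0 F ->
  cmap (diag_smap a) F j Q = a 0 j * F j Q.
Proof.
move=> F0; rewrite -[F in RHS]smap_id_comp //.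
have e : eqdeg (mdeg Q) (tr (mdeg Q) (cmap (diag_smap a) F j))
    (a 0 j *: tr (mdeg Q) (cmap (@smap_id R n) F j)).
  apply: eqdeg_trans (trunc_comp _ F0) _; apply: eqdeg_sym.
  rewrite /diag_smap truncZ substZ; apply: eqdegZ; exact: trunc_comp.
by have := e Q (leqnn _); rewrite mcoeffZ !mcoeff_trunc leqnn.
Qed.

Definition diag_invariant f := forall Q, f Q != 0 -> forall m, mu_pow mu m Q = 1.

Definition resonant j Q := [forall m, mu_pow mu m Q == mu m j].

Lemma resonantP j Q : reflect (forall m, mu_pow mu m Q = mu m j) (resonant j Q).
Proof. exact: (iffP 'forall_eqP). Qed.

(** Commutation with the [D_m], read on the coefficients (see [equivariantP]). *)
Definition equivariant F := forall j Q, F j Q != 0 -> resonant j Q.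

Lemma diag_invariantP f :
  (forall m, scomp f (diag_smap (row m mu)) = f) <-> diag_invariant f.
Proof.
split=> [h Q fQ m|h m].
  have := congr1 (@^~ Q) (h m); rewrite comp_diag -[RHS]mulr1.
  by apply: mulfI.
apply: funext => Q; rewrite comp_diag.
by have [->|fQ] := eqVneq (f Q) 0; rewrite ?mul0r // h // mulr1.
Qed.

Lemma equivariantP F : fixes0 F ->
  (forall m, cmap F (diag_smap (row m mu)) = cmap (diag_smap (row m mu)) F)
  <-> equivariant F.
Proof.
move=> F0; split=> [h j Q fQ|h m].
  apply/resonantP => m.
  have := congr1 (fun G => G j Q) (h m); rewrite diag_comp // mxE cmapE comp_diag.
  by rewrite [RHS]mulrC; apply: mulfI.
apply: funext => j; apply: funext => Q; rewrite diag_comp // mxE.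
rewrite cmapE comp_diag mulrC.
have [->|fQ] := eqVneq (F j Q) 0; first by rewrite !mulr0.
by have /resonantP -> := h _ _ fQ.
Qed.

Lemma weighted_diag_invariant N f : diag_invariant f -> weighted (fun=> 1) (tr N f).
Proof.
by move=> h Q; rewrite mcoeff_trunc; case: leqP => [_|]; [apply: h | rewrite eqxx].
Qed.

Lemma weighted_equivariant N F j : equivariant F ->
  weighted (fun m => mu m j) (tr N (F j)).
Proof.
move=> h Q; rewrite mcoeff_trunc; case: leqP => [_|]; last by rewrite eqxx.
by move=> /h /resonantP.
Qed.

Lemma weights_comp f G P : fixes0 G -> equivariant G -> scomp f G P != 0 ->
  exists2 Q, f Q != 0 & forall m, mu_pow mu m P = mu_pow mu m Q.
Proof.
move=> G0 hG; have /(_ P (leqnn _)) := @trunc_comp R n (mdeg P) f _ G0.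
rewrite mcoeff_trunc leqnn => -> /weights_subst[k|Q].
  exact: weighted_equivariant.
by rewrite mcoeff_trunc; case: ifP => [_ hQ|]; [exists Q | rewrite eqxx].
Qed.

End Weights.

(** * Removing the resonant monomials from the conjugacy *)

Section Normalization.
Context (R : realType) (n l : nat) (mu : 'M[R[i]]_(l, n)).
Implicit Types (f g : series R n) (F G Phi Psi : smap R n).
Implicit Types (nu : 'I_n -> series R n) (Q P : 'X_{1..n}).

Lemma scompB f g G : fixes0 G ->
  scomp (ssub f g) G = ssub (scomp f G) (scomp g G).
Proof.
move=> G0; apply: series_eqP => N; apply: eqdeg_trans (trunc_comp _ G0) _.
apply: eqdeg_sym; rewrite !truncB substB.
by apply: eqdegB; apply: trunc_comp.
Qed.

Definition hat nu : smap R n := fun j => smul (nu j) (series_var R j).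

Lemma trunc_hat N nu j : eqdeg N (tr N (hat nu j)) (tr N (nu j) * 'X_j).
Proof.
apply: eqdeg_trans (trunc_mul _ _) _; apply: eqdegM => //.
exact: trunc_var.
Qed.

Lemma hat_fixes0 nu : fixes0 (hat nu).
Proof.
move=> j; have /(_ 0%MM) := @trunc_hat 0 nu j.
rewrite mcoeff_trunc mdeg0 leqnn => -> //.
have : vanishing (0 + 1) (tr 0 (nu j) * 'X_j).
  by apply: vanishingM => //; rewrite -(mdeg1 j); apply: vanishing_mon.
by apply; rewrite mdeg0.
Qed.

(** The half of condition (ii) that passes from the linear parts to the series; the other half is
    evaluation at 0. *)
Definition integrable (nu : 'I_l -> 'I_n -> series R n) := forall j Q,
  (1 < mdeg Q)%N -> resonant mu j Q -> forall m, smpow (nu m) Q = nu m j.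

(** Substituting [hat (nu m)] in [z^P] gives [nu_m^P z^P]. For a resonant [P] of degree at least
    two, condition (ii) replaces [nu_m^P] by [nu_mj]; in lower degree, tangency to the identity
    leaves only the monomial [z_j]. *)
Lemma equivariant_hat (nu : 'I_l -> 'I_n -> series R n) F m j :
  integrable nu -> tangent_to_id F -> equivariant mu F ->
  cmap F (hat (nu m)) j = smul (nu m j) (F j).
Proof.
move=> inu tF eF; apply: series_eqP => N.
apply: eqdeg_trans (trunc_comp _ (hat_fixes0 _)) _; apply: eqdeg_sym.
apply: eqdeg_trans (trunc_mul _ _) _; apply: eqdeg_sym.
apply: (@eqdeg_trans _ _ _ _ (subst (fun k => tr N (nu m k) * 'X_k) (tr N (F j)))).
  by apply: eqdeg_subst_in => k; apply: trunc_hat.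
rewrite truncE subst_sum mulr_sumr; apply: eqdeg_sum => -[P /= _] _.
rewrite substZ -scalerAr; have [->|hP] := eqVneq (F j P) 0; first by rewrite !scale0r.
apply: eqdegZ; rewrite substXm; under eq_bigr do rewrite exprMn.
rewrite big_split /= -[X in _ * X]substXm subst_id; apply: eqdegM => //.
have rP := eF _ _ hP.
have [h|h] := ltnP 1 (mdeg P).
  by rewrite -(inu j P h rP m); apply: eqdeg_sym; apply: trunc_mpow.
move: hP; have -> : F j P = series_var R j P by move/tangentP: tF => ->.
rewrite /series_var; have [-> _|] := eqVneq P U_(j)%MM; last by rewrite eqxx.
rewrite (bigD1 j) //= mnm1E eqxx expr1 big1 ?mulr1 // => k hk.
by rewrite mnm1E eq_sym (negbTE hk) expr0.
Qed.

Definition resonant_part F : smap R n :=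
  fun j Q => if resonant mu j Q then F j Q else 0.

Lemma resonantU j : resonant mu j U_(j)%MM.
Proof. by apply/resonantP => m; rewrite mu_powU. Qed.

Lemma resonant_part_tangent F : tangent_to_id F -> tangent_to_id (resonant_part F).
Proof.
move=> /tangentP h; apply/tangentP => j Q hQ; rewrite /resonant_part h //.
rewrite /series_var; have [->|] := eqVneq Q U_(j)%MM; last by rewrite if_same.
by rewrite resonantU.
Qed.

Lemma resonant_part_equivariant F : equivariant mu (resonant_part F).
Proof. by move=> j Q; rewrite /resonant_part; case: ifP => //; rewrite eqxx. Qed.

Definition conjugated Phi (F : 'I_l -> smap R n) (nu : 'I_l -> 'I_n -> series R n) :=
  forall m, cmap (F m) Phi = cmap Phi (hat (nu m)).

(* Composing [Phi] with the inverse of its resonant part, which commutes with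
   the linear parts, removes all the resonant terms of [Phi]. *)
Lemma normalization Phi Psi (F : 'I_l -> smap R n)
    (nu : 'I_l -> 'I_n -> series R n) :
  tangent_to_id Phi -> fixes0 Psi ->
  cmap Phi Psi = @smap_id R n -> cmap Psi Phi = @smap_id R n ->
  conjugated Phi F nu -> (forall m j, nu m j 0%MM = mu m j) ->
  (forall m j, diag_invariant mu (nu m j)) -> integrable nu ->
  exists Phi' Psi', exists nu' : 'I_l -> 'I_n -> series R n,
  [/\ [/\ tangent_to_id Phi', fixes0 Psi',
          cmap Phi' Psi' = @smap_id R n & cmap Psi' Phi' = @smap_id R n],
      conjugated Phi' F nu',
      [/\ forall m j, nu' m j 0%MM = mu m j, forall m j, diag_invariant mu (nu' m j) &
          integrable nu'] &
      forall j Q, resonant mu j Q -> Phi' j Q = series_var R j Q].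
Proof.
move=> tP Ps0 e e' cF nu0 nuI inu.
set A := resonant_part Phi; pose T := formal_inverse A.
have tA : tangent_to_id A by apply: resonant_part_tangent.
have [A0 _] := tA; have [P0 _] := tP.
have tT : tangent_to_id T by apply: formal_inverse_tangent.
have [T0 _] := tT.
have AT : cmap A T = @smap_id R n by apply: formal_inverseVr.
have TA : cmap T A = @smap_id R n by apply: formal_inverseVl.
have eA : equivariant mu A by apply: resonant_part_equivariant.
have eT : equivariant mu T.
  apply/equivariantP => // m; apply: (inverse_commute A0 T0 _ AT TA).
    exact: diag_fixes0.
  by move: m; apply/equivariantP.
have H0 m : fixes0 (hat (nu m)) by apply: hat_fixes0.
exists (cmap Phi T), (cmap A Psi), (fun m j => scomp (nu m j) T); split.
- split; [exact: tangent_comp|exact: fixes0_comp| |].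
    rewrite smap_compA //; last exact: fixes0_comp.
    by rewrite -(smap_compA T) // TA smap_id_comp.
  rewrite smap_compA //; last exact: fixes0_comp.
  by rewrite -(smap_compA Psi) // e' smap_id_comp.
- move=> m; rewrite -smap_compA // cF smap_compA // smap_compA //; last exact: hat_fixes0.
  (* By [equivariant_hat], [A o hat (nu m)] has components [nu_mj A_j], so [A o hat (nu m) o T] has
     components [nu_mj(T) (A o T)_j = nu_mj(T) z_j]: the normal form is kept. *)
  congr cmap; rewrite -[cmap (hat _) T]smap_id_comp; last exact: fixes0_comp.
  rewrite -TA smap_compA //; last exact: fixes0_comp.
  congr cmap; rewrite -smap_compA //; apply: funext => j.
  rewrite cmapE (equivariant_hat _ _ inu) // series_mul_comp // -(cmapE A) AT.
  by [].
- split=> [m j|m j Q hQ m'|j Q hQ rQ m].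
  + by rewrite series_comp0.
  + have [P hP ->] := weights_comp T0 eT hQ; exact: nuI hP _.
  + by rewrite -series_mpow_comp // (inu j).
- move=> j Q rQ; rewrite cmapE.
  (* [Phi - A] has no resonant monomial and composing with the equivariant [T] creates none, so the
     resonant monomials of [Phi o T] are those of [A o T = id]. *)
  have : scomp (ssub (Phi j) (A j)) T Q = 0.
    apply/eqP; apply: contraT => /(weights_comp T0 eT)[P hP eP].
    move: hP; rewrite ssubE /A /resonant_part; case: ifP => [_|/negP[]].
      by rewrite subrr eqxx.
    by apply/resonantP => m; rewrite -eP; move/resonantP: rQ => ->.
  rewrite scompB // ssubE => /eqP; rewrite subr_eq0 => /eqP ->.
  by rewrite -(cmapE A) AT.
Qed.

End Normalization.

(** * Truncated weighted [l^1] norms *)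

Section MajorantNorm.
Context (R : realType) (n : nat).
Implicit Types (p q : {mpoly R[i][n]}) (A B : {mpoly R[n]}) (r s : R).
Implicit Types (Q P : 'X_{1..n}) (z : R[i]).

Lemma normc_ge0 z : 0 <= normc z.
Proof. by case: z => a b; apply: sqrtr_ge0. Qed.

Lemma normcD z1 z2 : normc (z1 + z2) <= normc z1 + normc z2.
Proof. exact: le_normcD. Qed.

Lemma normcX z k : normc (z ^+ k) = normc z ^+ k.
Proof. by elim: k => [|k ih]; rewrite ?normc1 // !exprS normcM ih. Qed.

Lemma normc_gt0 z : (0 < normc z) = (z != 0).
Proof.
rewrite lt_def normc_ge0 andbT; have [->|h] := eqVneq z 0; first by rewrite normc0 eqxx.
by apply: contra_neq h => /eq0_normc.
Qed.

Lemma normc_sum (I : Type) (r : seq I) (P : pred I) (f : I -> R[i]) :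
  normc (\sum_(i <- r | P i) f i) <= \sum_(i <- r | P i) normc (f i).
Proof.
apply: (big_ind2 (fun a b => normc a <= b)) => //; first by rewrite normc0.
move=> a b a' b' h h'; apply: le_trans (normcD _ _) _; exact: lerD.
Qed.

Lemma normc_prod (I : Type) (r : seq I) (P : pred I) (f : I -> R[i]) :
  normc (\prod_(i <- r | P i) f i) = \prod_(i <- r | P i) normc (f i).
Proof. by apply: (big_morph _ (@normcM R)); apply: normc1. Qed.

(** The truncation is part of the norm: polynomials related by [eqdeg N] get the same value, and the
    norm remains submultiplicative. *)
Definition wnorm r (N : nat) p : R :=
  \sum_(Q : 'X_{1..n < N.+1}) normc p@_Q * r ^+ mdeg Q.

(** The majorant of [p]: its value at [(r, ..., r)] is [wnorm r N p], so inequalities of norms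
    reduce to inequalities between coefficients. *)
Definition absm N p : {mpoly R[n]} :=
  \sum_(Q : 'X_{1..n < N.+1}) normc p@_Q *: 'X_[Q].

Lemma mcoeff_absm N p Q :
  (absm N p)@_Q = if (mdeg Q <= N)%N then normc p@_Q else 0.
Proof.
rewrite /absm; case: leqP => h.
  by rewrite (mcoeff_mpoly (fun Q => normc p@_Q)).
rewrite raddf_sum big1 // => -[P hP] _ /=; rewrite mcoeffZ mcoeffX.
by case: eqP => [e|]; rewrite ?mulr0 //; move: hP h; rewrite e; lia.
Qed.

Lemma absm_ge0 N p Q : 0 <= (absm N p)@_Q.
Proof. by rewrite mcoeff_absm; case: ifP => // _; apply: normc_ge0. Qed.

Lemma meval_absm r N p : (absm N p).@[fun=> r] = wnorm r N p.
Proof.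
rewrite /absm raddf_sum; apply: eq_bigr => Q _.
rewrite /= mevalZ mevalX; congr (_ * _).
by rewrite mdegE prodrXr.
Qed.

Lemma meval_le r A B : 0 <= r ->
  (forall Q, A@_Q <= B@_Q) -> A.@[fun=> r] <= B.@[fun=> r].
Proof.
move=> r0 h; rewrite -subr_ge0 -raddfB /= mevalE; apply: sumr_ge0 => Q _.
apply: mulr_ge0; first by rewrite mcoeffB subr_ge0.
by apply: prodr_ge0 => i _; apply: exprn_ge0.
Qed.

Lemma wnorm_ge0 r N p : 0 <= r -> 0 <= wnorm r N p.
Proof.
by move=> r0; apply: sumr_ge0 => Q _; rewrite mulr_ge0 ?exprn_ge0 ?normc_ge0.
Qed.

Lemma wnorm_eqdeg r N p q : eqdeg N p q -> wnorm r N p = wnorm r N q.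
Proof.
by move=> e; apply: eq_bigr => Q _; rewrite e // -ltnS bmdeg.
Qed.

Lemma wnorm0 r N : wnorm r N 0 = 0.
Proof. by apply: big1 => Q _; rewrite mcoeff0 normc0 mul0r. Qed.

Lemma wnorm_vanishing r N p : vanishing N.+1 p -> wnorm r N p = 0.
Proof.
by move=> h; apply: big1 => Q _; rewrite h ?bmdeg // normc0 mul0r.
Qed.

Lemma wnormD r N p q : 0 <= r -> wnorm r N (p + q) <= wnorm r N p + wnorm r N q.
Proof.
move=> r0; rewrite -big_split; apply: ler_sum => Q _ /=.
by rewrite -mulrDl mcoeffD ler_wpM2r ?exprn_ge0 // normcD.
Qed.

Lemma wnormN r N p : wnorm r N (- p) = wnorm r N p.
Proof. by apply: eq_bigr => Q _; rewrite mcoeffN normcN. Qed.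

Lemma wnormB r N p q : 0 <= r -> wnorm r N (p - q) <= wnorm r N p + wnorm r N q.
Proof. by move=> r0; rewrite -(wnormN _ _ q); apply: wnormD. Qed.

Lemma wnorm_subr r N p q : 0 <= r -> wnorm r N p - wnorm r N q <= wnorm r N (p - q).
Proof. by move=> r0; rewrite lerBlDr -{1}(subrK q p) wnormD. Qed.

Lemma wnormZ r N z p : wnorm r N (z *: p) = normc z * wnorm r N p.
Proof.
rewrite /wnorm mulr_sumr; apply: eq_bigr => Q _.
by rewrite mcoeffZ normcM mulrA.
Qed.

Lemma wnormM r N p q : 0 <= r -> wnorm r N (p * q) <= wnorm r N p * wnorm r N q.
Proof.
move=> r0; rewrite -!meval_absm -mevalM; apply: meval_le => // Q.
rewrite mcoeff_absm; case: leqP => h; last first.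
  by rewrite mcoeffM; apply: sumr_ge0 => k _; rewrite mulr_ge0 ?absm_ge0.
rewrite !mcoeffM; apply: le_trans (normc_sum _ _ _) _.
apply: ler_sum => -[[k1 h1] [k2 h2]] /= _; rewrite normcM !mcoeff_absm.
by rewrite !(leq_trans _ h) //; rewrite -ltnS.
Qed.

Lemma wnormC r N z : wnorm r N z%:MP = normc z.
Proof.
rewrite /wnorm (bigD1 bm0) //= mcoeffC eqxx mulr1 mdeg0 expr0 mulr1.
rewrite big1 ?addr0 // => Q hQ; rewrite mcoeffC.
have /negbTE -> : bmnm Q != 0%MM by apply: contra_neq hQ => e; apply: val_inj.
by rewrite mulr0 normc0 mul0r.
Qed.

Lemma wnorm_mon r N Q : 0 <= r -> wnorm r N 'X_[Q] <= r ^+ mdeg Q.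
Proof.
move=> r0; have [h|h] := leqP (mdeg Q) N; last first.
  by rewrite wnorm_vanishing ?exprn_ge0 //; apply: vanishing_leq (@vanishing_mon _ _ Q).
rewrite /wnorm (bigD1 (BMultinom (h : mdeg Q < N.+1)%N)) //= mcoeffX eqxx normc1 mul1r.
rewrite big1 ?addr0 // => P hP; rewrite mcoeffX.
have /negbTE -> : Q != bmnm P by apply: contra_neq hP => e; apply: val_inj.
by rewrite normc0 mul0r.
Qed.

Lemma wnorm_var r N (j : 'I_n) : 0 <= r -> wnorm r N 'X_j <= r.
Proof. by move=> r0; have := @wnorm_mon r N U_(j) r0; rewrite mdeg1. Qed.

Lemma wnormX r N p s k : 0 <= r -> wnorm r N p <= s -> wnorm r N (p ^+ k) <= s ^+ k.
Proof.
move=> r0 h; elim: k => [|k ih]; first by rewrite !expr0 -mpolyC1 wnormC normc1.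
rewrite !exprS; apply: le_trans (wnormM _ _ _ r0) _.
by apply: ler_pM => //; apply: wnorm_ge0.
Qed.

Lemma wnorm_mulX r N p (j : 'I_n) : wnorm r N.+1 (p * 'X_j) = wnorm r N p * r.
Proof.
rewrite -!meval_absm -[X in _ = _ * X](mevalXU (fun=> r) j) -mevalM; congr meval.
apply/mpolyP => Q; rewrite mcoeff_absm.
have [/submK|hQ] := boolP (U_(j) <= Q)%MM.
  by rewrite addmC => <-; rewrite !mcoeffMX mcoeff_absm mdegD mdeg1 add1n ltnS.
have h (K : comNzRingType) (A : {mpoly K[n]}) : (A * 'X_j)@_Q = 0.
  apply: memN_msupp_eq0; apply: contra hQ.
  rewrite (perm_mem (msuppMX _ _)) => /mapP[P _ ->].
  exact: lem_addr.
by rewrite !h normc0 if_same.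
Qed.

(** All monomials of [p] have degree at least two, so shrinking the radius from [r] to [s] gains at
    least the factor [(s / r)^2]. All smallness in the bootstraps comes from here. *)
Lemma wnorm_order2 r s N p : 0 < r -> 0 <= s -> s <= r -> vanishing 2 p ->
  wnorm s N p <= (s / r) ^+ 2 * wnorm r N p.
Proof.
move=> r0 s0 sr hp; rewrite /wnorm mulr_sumr; apply: ler_sum => Q _.
have [h|h] := ltnP (mdeg Q) 2; first by rewrite hp // normc0 !mul0r mulr0.
rewrite mulrCA ler_wpM2l ?normc_ge0 // -(subnK h) !exprD.
set d := (mdeg Q - 2)%N.
have -> : (s / r) ^+ 2 * (r ^+ d * r ^+ 2) = r ^+ d * s ^+ 2 by field; rewrite gt_eqF.
by rewrite ler_wpM2r ?exprn_ge0 // lerXn2r // ?nnegrE // ltW.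
Qed.

Lemma wnorm_subst r s N (G : 'I_n -> {mpoly R[i][n]}) p : 0 <= r -> 0 <= s ->
  (forall i, vanishing 1 (G i)) -> (forall i, wnorm r N (G i) <= s) ->
  wnorm r N (subst G p) <= wnorm s N p.
Proof.
move=> r0 s0 G1 hG.
(* [G] has no constant term, so [p] may be cut at degree [N], and [wnorm s N p] then sees all of its
   terms. *)
set p' : {mpoly R[i][n]} := \sum_(Q : 'X_{1..n < N.+1}) p@_Q *: 'X_[Q].
have e : eqdeg N p p'.
  by move=> Q hQ; rewrite /p' (mcoeff_mpoly (fun Q => p@_Q)).
rewrite (wnorm_eqdeg _ (eqdeg_subst G1 e (fun i => @eqdeg_refl _ _ N (G i)))).
rewrite /p' subst_sum.
apply: (@le_trans _ _ (\sum_(Q : 'X_{1..n < N.+1}) wnorm r N (subst G (p@_Q *: 'X_[Q])))).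
  apply: (big_ind2 (fun a b => wnorm r N a <= b)) => //; first by rewrite wnorm0.
  by move=> a b a' b' h h'; apply: le_trans (wnormD _ _ _ r0) _; exact: lerD.
apply: ler_sum => Q _; rewrite substZ wnormZ ler_wpM2l ?normc_ge0 //.
rewrite substXm mdegE -prodrXr.
elim: (index_enum _) => [|i I ih].
  by rewrite !big_nil -mpolyC1 wnormC normc1.
rewrite !big_cons; apply: le_trans (wnormM _ _ _ r0) _.
by apply: ler_pM => //; rewrite ?wnorm_ge0 //; apply: wnormX.
Qed.

End MajorantNorm.

(** * Convergence as boundedness of the truncated norms *)

Section Convergence.
Context (R : realType).

Lemma summableP (T : choiceType) (a : T -> R) : (forall x, 0 <= a x) ->
  esum.summable (@classical_sets.setT T) (fun x => EFin (a x))
  <-> exists M, forall s : seq T, uniq s -> \sum_(x <- s) a x <= M.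
Proof.
move=> a0; rewrite /esum.summable.
have -> : (fun x => abse (EFin (a x))) =
    (fun x => EFin (a x)).
  by apply: funext => x; rewrite /= ger0_norm.
split=> [|[M hM]].
- have bound (s : seq T) : uniq s -> Order.le
      (EFin (\sum_(x <- s) a x))
      (esum.esum (@classical_sets.setT T) (fun x => EFin (a x))).
    move=> us; apply: esum.esum_ge; exists (classical_sets.mkset (fun x => x \in s)).
      by split => //; apply: cardinality.finite_seq.
    by rewrite -fsbigop.fsbig_seq // sumEFin.
  move: bound; case: (esum.esum _ _) => [M hM _|//|h _].
    by exists M => s us; have := hM s us; rewrite lee_fin.
  by have := h [::] isT; rewrite leeNy_eq.
- apply: (@Order.POrderTheory.le_lt_trans _ _ (EFin M));
    last exact: ltry.
  apply: ereal.ge_ereal_sup => _ [X [fX _] <-].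
  rewrite fsbigop.fsbig_finite // sumEFin.
  by rewrite lee_fin; apply: hM; apply: finmap.fset_uniq.
Qed.

Context (n : nat).
Implicit Types (f : series R n).

Lemma convergent_wnorm f : convergent f ->
  exists r M, 0 < r /\ forall N, wnorm r N (tr N f) <= M.
Proof.
case=> r r0 h.
(* Summability at the single point [(r / 2, ..., r / 2)], strictly inside the polydisc, bounds all
   the truncated norms of radius [r / 2]. *)
have r2 : 0 < r / 2 by rewrite divr_gt0.
have nr : normc (r / 2)%:C%C = r / 2.
  by rewrite /= expr0n addr0 sqrtr_sqr ger0_norm // ltW.
have hr (i : 'I_n) : normc (r / 2)%:C%C < r.
  by rewrite nr ltr_pdivrMr // mulr_natr mulr2n ltrDr.
have /summableP[Q|M hM] := h (fun=> (r / 2)%:C%C) hr; first exact: normc_ge0.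
exists (r / 2), M; split=> // N.
have /hM : uniq [seq bmnm Q | Q <- enum {: 'X_{1..n < N.+1}}].
  by rewrite map_inj_uniq ?enum_uniq //; apply: val_inj.
apply: le_trans; rewrite big_map big_enum /=; apply: ler_sum => Q _.
rewrite mcoeff_trunc -ltnS bmdeg normcM prodrXr -mdegE normcX.
by rewrite nr.
Qed.

Lemma wnorm_convergent f r M : 0 < r ->
  (forall N, wnorm r N (tr N f) <= M) -> convergent f.
Proof.
move=> r0 h; exists r => // z hz; apply/summableP; first by move=> Q; apply: normc_ge0.
exists M => s us; set N := \max_(Q <- s) mdeg Q.
apply: le_trans (h N); rewrite /wnorm.
have hs Q : Q \in s -> (mdeg Q < N.+1)%N.
  by move=> hQ; rewrite ltnS /N (big_rem Q) //= leq_maxl.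
pose I : subFinType _ := 'X_{1..n < N.+1}.
rewrite (ssrcomplements.big_mksub I) //= big_mkcond; apply: ler_sum => Q _.
rewrite mcoeff_trunc -ltnS bmdeg; case: ifP => _; last first.
  by rewrite mulr_ge0 ?normc_ge0 // exprn_ge0 // ltW.
rewrite normcM ler_wpM2l ?normc_ge0 // normc_prod mdegE -prodrXr.
apply: ler_prod => i _; rewrite normcX exprn_ge0 ?normc_ge0 //=.
by rewrite lerXn2r ?nnegrE ?normc_ge0 // ltW.
Qed.

End Convergence.

(** * Uniform bound for the division by [a^Q - mu_ij] *)

Section DivisorBound.
Context (R : realType).
Implicit Types (r lam : R).

Lemma finite_bound (T : finType) (f : T -> R) :
  exists B, 1 <= B /\ forall t, f t <= B.
Proof.
exists (1 + \sum_t `|f t|); split=> [|t].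
  by rewrite lerDl sumr_ge0.
rewrite (bigD1 t) //= addrCA; apply: le_trans (ler_norm _) _.
by rewrite lerDl addr_ge0 ?sumr_ge0.
Qed.

Lemma bernoulli (x : R) m : 0 <= x -> 1 + m%:R * x <= (1 + x) ^+ m.
Proof.
move=> x0; elim: m => [|m ih]; first by rewrite mul0r addr0 expr0.
rewrite exprS; apply: le_trans (ler_wpM2l _ ih); last by rewrite addr_ge0.
rewrite -natr1; have : 0 <= m%:R * x * x by rewrite !mulr_ge0.
lra.
Qed.

Lemma exprn_unbounded (x y : R) : 1 < x ->
  exists K, forall m, (K <= m)%N -> y <= x ^+ m.
Proof.
move=> x1; have h : 0 < x - 1 by rewrite subr_gt0.
have := archi_boundP (normr_ge0 (y / (x - 1))).
set K := Num.Def.archi_bound _ => hK; exists K => m Km.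
have /(bernoulli m) : 0 <= x - 1 by apply: ltW.
rewrite [1 + (x - 1)]addrC subrK; apply: le_trans.
have : y / (x - 1) < m%:R.
  apply: le_lt_trans (ler_norm _) _; apply: lt_le_trans hK _.
  by rewrite ler_nat.
by rewrite ltr_pdivrMr // => /ltW h'; apply: le_trans h' _; rewrite lerDr.
Qed.

Lemma expr1D_le lam K : 0 <= lam -> lam <= 1 ->
  (1 + lam) ^+ K - 1 <= lam * 2 ^+ K.
Proof.
(* The sharper bound is the chord over [[0, 1]] of the convex function [(1 + lam)^K - 1]; it passes
   through the induction. *)
move=> l0 l1; suff : (1 + lam) ^+ K - 1 <= lam * (2 ^+ K - 1).
  by move/le_trans; apply; rewrite ler_wpM2l // lerBlDr lerDl.
elim: K => [|K ih]; first by rewrite !expr0 !subrr mulr0.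
rewrite !exprS; set x := (1 + lam) ^+ K in ih *; set t := 2 ^+ K in ih *.
have t1 : 1 <= t by rewrite /t exprn_ege1 // ler1n.
have h1 : 0 <= (1 + lam) * (lam * (t - 1) - (x - 1)).
  by rewrite mulr_ge0 ?subr_ge0 // addr_ge0.
have h2 : 0 <= lam * (t - 1) * (1 - lam) by rewrite !mulr_ge0 ?subr_ge0.
lra.
Qed.

Context (n : nat).
Implicit Types (p : {mpoly R[i][n]}) (a : 'I_n -> {mpoly R[i][n]}).
Implicit Types (z : 'I_n -> R[i]) (Q : 'X_{1..n}).

(** An induction that builds [a^Q] and [z^Q] side by side; the third argument of [rel] counts the
    factors used so far, hence ends at [|Q|]. *)
Lemma mpow_ind (rel : {mpoly R[i][n]} -> R[i] -> nat -> Prop) a z Q :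
  rel 1 1 0%N ->
  (forall A B (x y : R[i]) m k, rel A x m -> rel B y k -> rel (A * B) (x * y) (m + k)%N) ->
  (forall k, rel (a k) (z k) 1%N) ->
  rel (\prod_(k < n) a k ^+ Q k) (\prod_(k < n) z k ^+ Q k) (mdeg Q).
Proof.
move=> h1 hM ha; rewrite mdegE; elim: (index_enum _) => [|k I ih].
  by rewrite !big_nil.
rewrite !big_cons; apply: (hM) => //; elim: (Q k) => [|q ihq]; first by rewrite !expr0.
by rewrite !exprS -add1n; apply: hM.
Qed.

Section Perturbation.
Context (r : R) (N : nat) (lam : R) (a : 'I_n -> {mpoly R[i][n]}) (z : 'I_n -> R[i]).
Hypotheses (r0 : 0 <= r) (lam0 : 0 <= lam) (lam1 : lam <= 1).
Hypothesis az : forall k, wnorm r N (a k - (z k)%:MP) <= lam * normc (z k).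

Lemma wnorm_mpow_diff Q :
  wnorm r N (\prod_(k < n) a k ^+ Q k - (\prod_(k < n) z k ^+ Q k)%:MP) <=
  normc (\prod_(k < n) z k ^+ Q k) * ((1 + lam) ^+ mdeg Q - 1).
Proof.
apply: (@mpow_ind (fun A x m => wnorm r N (A - x%:MP) <=
  normc x * ((1 + lam) ^+ m - 1))) => [|A B x y m k hA hB|k].
- by rewrite mpolyC1 subrr wnorm0 expr0 subrr mulr0.
- rewrite mpolyCM.
  have -> : A * B - x%:MP * y%:MP = (A - x%:MP) * (B - y%:MP) +
      ((A - x%:MP) * y%:MP + x%:MP * (B - y%:MP)) by ring.
  apply: le_trans (wnormD _ _ _ r0) _.
  have h1 := wnormM N (A - x%:MP) (B - y%:MP) r0.
  have h2 := le_trans (wnormD N _ _ r0)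
    (lerD (wnormM N (A - x%:MP) y%:MP r0) (wnormM N x%:MP (B - y%:MP) r0)).
  rewrite !wnormC in h2; apply: le_trans (lerD h1 h2) _.
  move: hA hB (wnorm_ge0 N (A - x%:MP) r0) (wnorm_ge0 N (B - y%:MP) r0).
  rewrite normcM exprD; move: (normc_ge0 x) (normc_ge0 y).
  set u := wnorm _ _ _; set v := wnorm _ _ _; set s := (1 + lam) ^+ m.
  set t := (1 + lam) ^+ k => x0 y0 hu hv u0 v0.
  have e1 : u * v <= normc x * (s - 1) * (normc y * (t - 1)) by apply: ler_pM.
  have e2 : u * normc y <= normc x * (s - 1) * normc y by apply: ler_wpM2r.
  have e3 : normc x * v <= normc x * (normc y * (t - 1)) by apply: ler_wpM2l.
  apply: le_trans (lerD e1 (lerD e2 e3)) _.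
  by rewrite le_eqVlt; apply/orP; left; apply/eqP; ring.
- by apply: le_trans (az k) _; rewrite expr1 [1 + _]addrC addrK mulrC.
Qed.

Lemma wnorm_mpow_le Q :
  wnorm r N (\prod_(k < n) a k ^+ Q k) <=
  normc (\prod_(k < n) z k ^+ Q k) * (1 + lam) ^+ mdeg Q.
Proof.
have h := wnorm_mpow_diff Q; set x := \prod_(k < n) z k ^+ Q k in h *.
rewrite -(subrK x%:MP (\prod_(k < n) a k ^+ Q k)).
apply: le_trans (wnormD _ _ _ r0) _; rewrite wnormC -lerBrDr.
by apply: le_trans h _; rewrite mulrBr mulr1.
Qed.

(** Each [a k] is the constant [z k] up to a relative error [lam], so multiplying by it keeps at
    least the fraction [normc (z k) * (1 - lam)] of a norm. Peeling off the factors one by one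
    avoids estimating an inverse of [a^Q]. *)
Lemma wnorm_mpow_ge Q p :
  normc (\prod_(k < n) z k ^+ Q k) * (1 - lam) ^+ mdeg Q * wnorm r N p <=
  wnorm r N (\prod_(k < n) a k ^+ Q k * p).
Proof.
move: p; apply: (@mpow_ind (fun A x m => forall p,
  normc x * (1 - lam) ^+ m * wnorm r N p <= wnorm r N (A * p))) => [p|A B x y m k hA hB p|k p].
- by rewrite normc1 expr0 !mul1r.
- rewrite -(mulrA A); apply: le_trans (hA (B * p)).
  have -> : normc (x * y) * (1 - lam) ^+ (m + k) * wnorm r N p =
      normc x * (1 - lam) ^+ m * (normc y * (1 - lam) ^+ k * wnorm r N p).
    by rewrite normcM exprD; ring.
  by rewrite ler_wpM2l // mulr_ge0 ?normc_ge0 // exprn_ge0 // subr_ge0.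
- have -> : a k * p = (z k)%:MP * p - - ((a k - (z k)%:MP) * p) by ring.
  apply: le_trans (wnorm_subr _ _ _ r0).
  rewrite wnormN mul_mpolyC wnormZ expr1 mulrBr mulr1 mulrBl lerD2l lerN2.
  apply: le_trans (wnormM _ _ _ r0) _; apply: ler_wpM2r; first exact: wnorm_ge0.
  by rewrite mulrC.
Qed.

End Perturbation.

Lemma wnorm_mpow_sub_ge r N a Q w p : 0 <= r ->
  wnorm r N (\prod_(k < n) a k ^+ Q k * p) - normc w * wnorm r N p <=
  wnorm r N ((\prod_(k < n) a k ^+ Q k - w%:MP) * p).
Proof.
by move=> r0; rewrite mulrBl mul_mpolyC -wnormZ; apply: wnorm_subr.
Qed.

Lemma wnorm_sub_mpow_ge r N a Q w p : 0 <= r ->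
  (normc w - wnorm r N (\prod_(k < n) a k ^+ Q k)) * wnorm r N p <=
  wnorm r N ((\prod_(k < n) a k ^+ Q k - w%:MP) * p).
Proof.
move=> r0; rewrite -(wnormN _ _ (_ * p)).
have -> : - ((\prod_(k < n) a k ^+ Q k - w%:MP) * p) =
    w *: p - \prod_(k < n) a k ^+ Q k * p by rewrite -mul_mpolyC; ring.
apply: le_trans (wnorm_subr _ _ _ r0); rewrite mulrBl wnormZ lerD2l lerN2.
exact: wnormM.
Qed.

Context (l : nat) (mu : 'M[R[i]]_(l, n)).

(* Small divisors are absent: for [|Q|] large one of the two terms of
   [a^Q - mu_ij] dominates the other, and only finitely many [Q] are left. *)
Lemma divisor_bound d c : (forall m j, mu m j != 0) -> 1 < d -> 0 < c ->
  exists eps C, [/\ 0 < eps, 0 < C & forall i j Q,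
    mu_pow mu i Q - mu i j != 0 ->
    c^-1 * d ^+ mdeg Q < Num.max (normc (mu_pow mu i Q)) (normc (mu_pow mu i Q)^-1) ->
    forall r N a p, 0 <= r ->
      (forall k, wnorm r N (a k - (mu i k)%:MP) <= eps) ->
      wnorm r N p <= C * wnorm r N ((\prod_(k < n) a k ^+ Q k - (mu i j)%:MP) * p)].
Proof.
move=> mu0 d1 c0.
have [M [M1 hM]] := @finite_bound ('I_l * 'I_n)%type
  (fun ik => normc (mu ik.1 ik.2) + (normc (mu ik.1 ik.2))^-1).
have M0 : 0 < M by lra.
have d0 : 0 < d by lra.
have muM i k : normc (mu i k) <= M.
  by apply: le_trans (hM (i, k)); rewrite lerDl invr_ge0 normc_ge0.
have mupos i k : 0 < normc (mu i k) by rewrite normc_gt0.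
have muV i k : M^-1 <= normc (mu i k).
  rewrite -[leRHS]invrK lef_pV2 ?posrE ?invr_gt0 //.
  by apply: le_trans (hM (i, k)); rewrite lerDr ltW.
(* [e] lies midway between 1 and [d]: since [e] and [d / e] both exceed 1, the growth [d^|Q|]
   absorbs the accumulated error and an unbounded factor is left over. *)
pose e := (1 + d) / 2.
have e1 : 1 < e by rewrite /e; lra.
have de1 : 1 < d / e by rewrite ltr_pdivlMr ?mul1r /e; lra.
have [K1 hK1] := exprn_unbounded (2 * M * c) e1.
have [K2 hK2] := exprn_unbounded (2 * M * c) de1.
pose K := maxn K1 K2.
have [B [B1 hB]] := @finite_bound ('I_l * 'I_n * 'X_{1..n < K})%type
  (fun t => (normc (mu_pow mu t.1.1 t.2 - mu t.1.1 t.1.2))^-1).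
have B0 : 0 < B by lra.
pose W := (2 * M) ^+ K.
have W1 : 1 <= W by rewrite exprn_ege1 //; lra.
(* The first term yields [1 + lam <= e <= d * (1 - lam)], used for large [Q]. The second makes the
   error on [a^Q], for the finitely many small [Q], at most half of the lower bound [B^-1] on the
   divisors. *)
pose lam := Num.min ((d - 1) / (2 * d)) (2 * B * W)^-1.
have lam_d : lam <= (d - 1) / (2 * d) by rewrite /lam ge_min lexx.
have lam_B : lam <= (2 * B * W)^-1 by rewrite /lam ge_min lexx orbT.
have lam_gt0 : 0 < lam.
  by rewrite lt_min divr_gt0 ?invr_gt0 ?mulr_gt0 //; lra.
have lamd : lam * (2 * d) <= d - 1 by rewrite -ler_pdivlMr //; lra.
have lam_le1 : lam <= 1 by nra.
have up : 1 + lam <= e by rewrite /e; nra.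
have low : e <= d * (1 - lam) by rewrite /e; lra.
(* All eigenvalues have modulus at least [M^-1], so an absolute error [lam / M] is a relative error
   at most [lam]. The constant adds [2 * M] for large [Q] and [2 * B] for small [Q]. *)
exists (lam / M), (2 * M + 2 * B); split; [by rewrite divr_gt0|by lra|].
move=> i j Q hQ hmax r N a p r0 ha.
have az k : wnorm r N (a k - (mu i k)%:MP) <= lam * normc (mu i k).
  by apply: le_trans (ha k) _; rewrite ler_wpM2l ?muV // ltW.
set X := wnorm r N p; set Y := wnorm r N (_ * p).
have X0 : 0 <= X by apply: wnorm_ge0.
have Y0 : 0 <= Y by apply: wnorm_ge0.
have [small|large] := ltnP (mdeg Q) K.
  have := hB (i, j, BMultinom small) => /=.
  set D := mu_pow mu i Q - mu i j in hQ *.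
  have D0 : 0 < normc D by rewrite normc_gt0.
  move=> hD; have {hD} hD : B^-1 <= normc D.
    by rewrite -[leRHS]invrK lef_pV2 ?posrE ?invr_gt0.
  have diff := wnorm_mpow_diff r0 az Q.
  set E := wnorm _ _ _ in diff.
  have hE : E <= (2 * B)^-1.
    apply: le_trans diff _.
    have m1 : normc (\prod_(k < n) mu i k ^+ Q k) <= M ^+ mdeg Q.
      rewrite normc_prod mdegE -prodrXr; apply: ler_prod => k _.
      by rewrite normcX exprn_ge0 ?normc_ge0 //= lerXn2r ?nnegrE ?normc_ge0 // ltW.
    have m2 : 0 <= (1 + lam) ^+ mdeg Q - 1.
      by rewrite subr_ge0 exprn_ege1 // lerDl ltW.
    have m3 := expr1D_le (mdeg Q) (ltW lam_gt0) lam_le1.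
    apply: le_trans (ler_pM (normc_ge0 _) m2 m1 m3) _.
    rewrite mulrCA -exprMn [M * 2]mulrC.
    have m4 : (2 * M) ^+ mdeg Q <= W by rewrite ler_weXn2l //; [lra | apply: ltnW].
    apply: le_trans (ler_wpM2l (ltW lam_gt0) m4) _.
    rewrite -ler_pdivlMr; last by lra.
    by rewrite -invfM.
  have hY : (B^-1 - (2 * B)^-1) * X <= Y.
    have -> : Y = wnorm r N (D *: p -
        - ((\prod_(k < n) a k ^+ Q k - (mu_pow mu i Q)%:MP) * p)).
      by congr wnorm; rewrite /D -mul_mpolyC mpolyCB; ring.
    apply: le_trans (wnorm_subr _ _ _ r0); rewrite wnormZ wnormN mulrBl.
    apply: lerB; first exact: ler_wpM2r.
    by apply: le_trans (wnormM _ _ _ r0) _; apply: ler_wpM2r.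
  have {hY} hY : X <= 2 * B * Y.
    move: hY; have -> : B^-1 - (2 * B)^-1 = (2 * B)^-1 by field; rewrite gt_eqF.
    by rewrite mulrC ler_pdivrMr ?mulr_gt0 // mulrC.
  by apply: le_trans hY _; rewrite ler_wpM2r //; lra.
have [KK1 KK2] : (K1 <= mdeg Q)%N /\ (K2 <= mdeg Q)%N.
  by move: large; rewrite geq_max => /andP.
have {}hK1 := hK1 _ KK1; have {}hK2 := hK2 _ KK2.
have C2 : 2 * M * Y <= (2 * M + 2 * B) * Y by rewrite ler_wpM2r //; lra.
apply: le_trans C2.
have mupow0 : 0 < normc (mu_pow mu i Q).
  by rewrite normc_prod prodr_gt0 // => k _; rewrite normcX exprn_gt0.
move: hmax; rewrite lt_max => /orP[big|big].
(* Here [a^Q] dominates: it multiplies the norm of [p] by at least [2 * M], against at most [M] for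
   the eigenvalue. *)
- have lo := wnorm_mpow_ge r0 lam_le1 az Q p.
  have hY := wnorm_mpow_sub_ge N a Q (mu i j) p r0.
  have hX : 2 * M * X <= normc (mu_pow mu i Q) * (1 - lam) ^+ mdeg Q * X.
    apply: ler_wpM2r => //.
    apply: (@le_trans _ _ (c^-1 * d ^+ mdeg Q * (1 - lam) ^+ mdeg Q)); last first.
      by rewrite ler_wpM2r ?(ltW big) // exprn_ge0 // subr_ge0.
    rewrite -mulrA -exprMn [c^-1 * _]mulrC ler_pdivlMr //; apply: le_trans hK1 _.
    by rewrite lerXn2r ?nnegrE //; lra.
  have hj : normc (mu i j) * X <= M * X by apply: ler_wpM2r.
  have : M * X <= Y.
    apply: le_trans hY; rewrite -/X; apply: le_trans (lerB (le_trans hX lo) hj).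
    by rewrite -mulrBl ler_wpM2r //; lra.
  by nra.
(* Here the eigenvalue dominates: its modulus is at least [M^-1], and the norm of [a^Q] is at most
   half of that. *)
- have hi := wnorm_mpow_le r0 az Q.
  have hY := wnorm_sub_mpow_ge N a Q (mu i j) p r0.
  have hX : wnorm r N (\prod_(k < n) a k ^+ Q k) <= (2 * M)^-1.
    apply: le_trans hi _; rewrite -/(mu_pow mu i Q).
    have de0 : 0 < d ^+ mdeg Q by rewrite exprn_gt0.
    have b1 : normc (mu_pow mu i Q) * d ^+ mdeg Q < c.
      move: big; rewrite normcV => big.
      have : c * (c^-1 * d ^+ mdeg Q) < c * (normc (mu_pow mu i Q))^-1.
        by rewrite ltr_pM2l.
      by rewrite mulVKf ?gt_eqF // ltr_pdivlMr // mulrC.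
    have b2 : (1 + lam) ^+ mdeg Q <= e ^+ mdeg Q.
      by rewrite lerXn2r ?nnegrE //; lra.
    have ee0 : 0 < e ^+ mdeg Q by rewrite exprn_gt0 //; lra.
    move: hK2; rewrite expr_div_n ler_pdivlMr // => b3.
    rewrite -div1r ler_pdivlMr ?mulr_gt0 //.
    rewrite -(ler_pM2r c0) -(ler_pM2r ee0) mul1r.
    have := ler_wpM2l (ltW mupow0) b2; set u := normc _ in b1 mupow0 *.
    set s := (1 + lam) ^+ _; set t := e ^+ _ in b2 b3 ee0 *.
    set D := d ^+ _ in b1 b3 de0 * => b4.
    have b5 : u * s * (2 * M * c * t) <= u * t * D.
      apply: ler_pM => //; first by rewrite mulr_ge0 ?exprn_ge0 //; lra.
      by rewrite !mulr_ge0 //; lra.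
    have b6 : u * t * D <= c * t by rewrite mulrAC ler_wpM2r //; lra.
    by apply: le_trans (le_trans b5 b6); rewrite le_eqVlt; apply/orP; left; apply/eqP; ring.
  have : (2 * M)^-1 * X <= Y.
    apply: le_trans hY; rewrite -/X ler_wpM2r // lerBrDr.
    apply: le_trans (muV i j); apply: le_trans (lerD (lexx _) hX) _.
    by rewrite le_eqVlt; apply/orP; left; apply/eqP; field; rewrite gt_eqF.
  by rewrite mulrC ler_pdivrMr ?mulr_gt0 // mulrC.
Qed.

End DivisorBound.

(** * Norm of a composition, and convergence of inverses *)

Section Substitution.
Context (R : realType) (n : nat).
Implicit Types (r s : R) (f : series R n) (G : smap R n) (p : {mpoly R[i][n]}).

Lemma wnorm_succ r N p : (forall Q, (N < mdeg Q)%N -> p@_Q = 0) ->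
  wnorm r N.+1 p = wnorm r N p.
Proof.
move=> h; rewrite -!meval_absm; congr meval; apply/mpolyP => Q.
rewrite !mcoeff_absm; have [h1|h1] := leqP (mdeg Q) N; first by rewrite leqW.
by rewrite h // normc0 if_same.
Qed.

Lemma wnorm_radius r s N p : 0 <= r -> r <= s -> wnorm r N p <= wnorm s N p.
Proof.
move=> r0 rs; apply: ler_sum => Q _; rewrite ler_wpM2l ?normc_ge0 //.
by rewrite lerXn2r ?nnegrE // (le_trans r0).
Qed.

Lemma wnorm_trunc_var r N (j : 'I_n) : 0 <= r -> wnorm r N (tr N (series_var R j)) <= r.
Proof. by move=> r0; rewrite (wnorm_eqdeg _ (@trunc_var _ _ N j)) wnorm_var. Qed.

(** [G] is controlled only up to degree [N], but [f] has order two, so the composition is controlled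
    up to degree [N + 1]. The radius doubles because [G] is the identity plus an error of norm at
    most [r]. *)
Lemma wnorm_comp r N f G : 0 <= r -> (forall Q, (mdeg Q < 2)%N -> f Q = 0) ->
  fixes0 G -> (forall i, wnorm r N (tr N (ssub (G i) (series_var R i))) <= r) ->
  wnorm r N.+1 (tr N.+1 (scomp f G)) <= wnorm (2 * r) N.+1 (tr N.+1 f).
Proof.
move=> r0 hf G0 hG.
rewrite (wnorm_eqdeg _ (trunc_comp f G0)).
have e : eqdeg N.+1 (subst (fun i => tr N.+1 (G i)) (tr N.+1 f))
    (subst (fun i => tr N (G i)) (tr N.+1 f)).
  apply: eqdeg_subst2 => [i|i|i|].
  - exact: vanishing1_trunc.
  - exact: vanishing1_trunc.
  - exact: trunc_eqdeg.
  - by move=> Q hQ; rewrite mcoeff_trunc; case: leqP => // _; apply: hf.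
rewrite (wnorm_eqdeg _ e); apply: wnorm_subst => //.
- by rewrite mulr_ge0.
- by move=> i; apply: vanishing1_trunc.
move=> i; rewrite wnorm_succ; last first.
  by move=> Q hQ; rewrite mcoeff_trunc leqNgt hQ.
have -> : tr N (G i) = tr N (ssub (G i) (series_var R i)) + tr N (series_var R i).
  by rewrite truncB subrK.
apply: le_trans (wnormD _ _ _ r0) _; rewrite mulr_natl mulr2n.
by apply: lerD => //; apply: wnorm_trunc_var.
Qed.

Lemma common_radius (T : finType) (f : T -> series R n) :
  (forall t, convergent (f t)) ->
  exists r M, [/\ 0 < r, 0 <= M & forall t N, wnorm r N (tr N (f t)) <= M].
Proof.
move=> cv; have [rad hrad] := choice (fun t => convergent_wnorm (cv t)).
have [bd h] := choice hrad.
have [B [B1 hB]] := finite_bound (fun t => (rad t)^-1).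
have [M [M1 hM]] := finite_bound bd.
have B0 : 0 < B by lra.
exists B^-1, M; split; [by rewrite invr_gt0|by lra|].
move=> t N; have [r0 hr] := h t; apply: le_trans (hM t); apply: le_trans (hr N).
apply: wnorm_radius; first by rewrite invr_ge0 ltW.
by rewrite -[leRHS]invrK lef_pV2 ?posrE ?invr_gt0.
Qed.

(** The equation for [G] is the one satisfied by a right inverse of [id + phi]. A bound on [G] up to
    degree [N] gives one up to degree [N + 1], and the order two of [phi] lets the same [s] serve at
    each degree. *)
Lemma inverse_bound (phi : 'I_n -> series R n) G r M :
  0 < r -> 0 <= M -> fixes0 G -> (forall j Q, (mdeg Q < 2)%N -> phi j Q = 0) ->
  (forall j N, wnorm r N (tr N (phi j)) <= M) ->
  (forall j Q, G j Q = series_var R j Q - scomp (phi j) G Q) ->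
  exists2 s, 0 < s & forall j N, wnorm s N (tr N (ssub (G j) (series_var R j))) <= s.
Proof.
move=> r0 M0 G0 h2 hphi hG.
(* The first term keeps [2 * s] within the radius [r]; the second gives [(2 * s / r)^2 * M <= s]. *)
pose s := Num.min (r / 2) (r ^+ 2 / (4 * (M + 1))).
have s0 : 0 < s by rewrite lt_min !divr_gt0 ?mulr_gt0 ?exprn_gt0 //; lra.
have s1 : s <= r / 2 by rewrite ge_min lexx.
have s2 : s <= r ^+ 2 / (4 * (M + 1)) by rewrite ge_min lexx orbT.
exists s => // j N; elim: N j => [|N ih] j.
  rewrite wnorm_vanishing ?(ltW s0) //.
  by apply: vanishing1_trunc; rewrite ssubE G0 series_var0 subrr.
have -> : tr N.+1 (ssub (G j) (series_var R j)) = - tr N.+1 (scomp (phi j) G).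
  apply/mpolyP => Q; rewrite mcoeffN !mcoeff_trunc ssubE hG.
  by case: ifP; rewrite ?oppr0 // addrAC subrr add0r.
rewrite wnormN; apply: le_trans (wnorm_comp (ltW s0) (h2 j) G0 ih) _.
have h2s : 0 <= 2 * s by lra.
have h2r : 2 * s <= r by lra.
have hv : vanishing 2 (tr N.+1 (phi j)).
  by move=> Q hQ; rewrite mcoeff_trunc; case: leqP => // _; apply: h2.
apply: le_trans (wnorm_order2 N.+1 r0 h2s h2r hv) _.
apply: (@le_trans _ _ ((2 * s / r) ^+ 2 * M)).
  by rewrite ler_wpM2l ?sqr_ge0.
move: s2; rewrite ler_pdivlMr; last by lra.
move=> s2; rewrite expr_div_n mulrAC ler_pdivrMr ?exprn_gt0 //.
apply: (@le_trans _ _ (s * (s * (4 * (M + 1))))); last by rewrite ler_wpM2l // ltW.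
rewrite exprMn; have : 0 <= s * s by rewrite mulr_ge0 // ltW.
rewrite expr2; nra.
Qed.

End Substitution.

(** * Classes of exponents with a common multiplier *)

Section Classes.
Context (R : realType) (n : nat).
Implicit Types (f g phi : series R n) (Q P A : 'X_{1..n}) (p q : {mpoly R[i][n]}).

(** A polynomial with nonzero constant term is a unit among power series; it is cancelled degree by
    degree. *)
Lemma vanishing_cancel N p q : q@_0%MM != 0 -> vanishing N (p * q) -> vanishing N p.
Proof.
move=> q0; elim: N => // N ih v Q; rewrite ltnS => hQ.
have vp : vanishing N p by apply: ih; apply: vanishing_leq v.
have vq : vanishing 1 (q - (q@_0%MM)%:MP).
  move=> P; rewrite ltnS leqn0 mdeg_eq0 => /eqP ->.
  by rewrite mcoeffB mcoeffC eqxx mulr1 subrr.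
have := v Q hQ.
have -> : p * q = q@_0%MM *: p + p * (q - (q@_0%MM)%:MP).
  by rewrite -mul_mpolyC; ring.
rewrite mcoeffD mcoeffZ (vanishingM vp vq) ?addr0 ?addn1 // => /eqP.
by rewrite mulf_eq0 (negbTE q0) => /eqP.
Qed.

Lemma mcoeff_mulX_neq0 p P Q : (p * 'X_[P])@_Q != 0 ->
  exists2 A, Q = (P + A)%MM & p@_A != 0.
Proof.
rewrite -mcoeff_msupp (perm_mem (msuppMX _ _)) => /mapP[A hA ->].
by exists A; rewrite // -mcoeff_msupp.
Qed.

Definition class_part (E : 'X_{1..n} -> 'X_{1..n} -> Prop) Q0 f : series R n :=
  fun Q => if `[< E Q Q0 >] then f Q else 0.

Lemma wnorm_trunc r N f : wnorm r N (tr N f) =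
  \sum_(Q : 'X_{1..n < N.+1}) normc (f Q) * r ^+ mdeg Q.
Proof. by apply: eq_bigr => Q _; rewrite mcoeff_trunc -ltnS bmdeg. Qed.

(** The classes partition the monomials and an [l^1] norm is additive over a partition, so the
    constant does not grow with the number of classes. The index [i] may change with the class,
    hence the sum over [i]. *)
Lemma wnorm_class (E : 'X_{1..n} -> 'X_{1..n} -> Prop) r N (C : R) l phi
    (G : 'I_l -> series R n) :
  (forall Q, E Q Q) -> (forall Q P, E Q P -> E P Q) ->
  (forall Q P A, E Q P -> E P A -> E Q A) -> 0 <= r -> 0 <= C ->
  (forall Q0, (mdeg Q0 <= N)%N -> phi Q0 != 0 -> exists i,
     wnorm r N (tr N (class_part E Q0 phi)) <=
     C * wnorm r N (tr N (class_part E Q0 (G i)))) ->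
  wnorm r N (tr N phi) <= C * \sum_i wnorm r N (tr N (G i)).
Proof.
move=> Er Es Et r0 C0 h.
(* [pick] depends only on its predicate, hence [rep] only on the class; the default is never
   reached, as [E Q Q] holds. *)
pose rep (Q : 'X_{1..n < N.+1}) : 'X_{1..n < N.+1} :=
  odflt Q [pick P : 'X_{1..n < N.+1} | `[< E P Q >]].
have repE (Q : 'X_{1..n < N.+1}) : E (rep Q) Q.
  by rewrite /rep; case: pickP => [P /asboolP|_] //=; apply: Er.
have rep_eq (Q P : 'X_{1..n < N.+1}) : (rep Q == rep P) = `[< E Q P >].
  apply/eqP/asboolP => [e|e].
    by apply: Et (Es _ _ (repE Q)) _; rewrite e; apply: repE.
  have ep : (fun B : 'X_{1..n < N.+1} => `[< E B Q >]) =1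
      (fun B : 'X_{1..n < N.+1} => `[< E B P >]).
    move=> B; apply/asboolP/asboolP => h1; first exact: Et h1 e.
    exact: Et h1 (Es _ _ e).
  rewrite /rep (eq_pick ep); case: pickP => // /(_ P).
  by move/asboolP: (Er P) => ->.
rewrite wnorm_trunc (partition_big rep predT) //=.
under [X in _ <= C * X]eq_bigr do rewrite wnorm_trunc (partition_big rep predT) //=.
rewrite exchange_big mulr_sumr /=; apply: ler_sum => B _.
have pos i : 0 <= \sum_(Q | rep Q == B) normc (G i Q) * r ^+ mdeg Q.
  by apply: sumr_ge0 => Q _; rewrite mulr_ge0 ?normc_ge0 ?exprn_ge0.
have [Q0 /andP[/eqP eB hQ0]|none] :=
    pickP (fun Q : 'X_{1..n < N.+1} => (rep Q == B) && (phi Q != 0)); last first.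
  rewrite big1 ?mulr_ge0 ?sumr_ge0 // => Q eQ; have := none Q.
  by rewrite eQ /= => /negbFE/eqP ->; rewrite normc0 mul0r.
have sumE f : \sum_(Q | rep Q == B) normc (f (bmnm Q)) * r ^+ mdeg Q =
    wnorm r N (tr N (class_part E Q0 f)).
  rewrite wnorm_trunc big_mkcond /=; apply: eq_bigr => Q _.
  by rewrite -eB rep_eq /class_part; case: ifP => //; rewrite normc0 mul0r.
have [|i hi] := h Q0 _ hQ0; first by rewrite -ltnS bmdeg.
rewrite sumE; apply: le_trans hi _; rewrite ler_wpM2l // (bigD1 i) //= -sumE.
by rewrite lerDl sumr_ge0.
Qed.

Context (l : nat) (mu : 'M[R[i]]_(l, n)) (nu : 'I_l -> 'I_n -> series R n).
Hypotheses (mu_neq0 : forall m j, mu m j != 0)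
  (nu0 : forall m j, nu m j 0%MM = mu m j)
  (nu_invariant : forall m j, diag_invariant mu (nu m j))
  (nu_integrable : integrable mu nu).

Definition nu_pow N m Q : {mpoly R[i][n]} := \prod_(k < n) tr N (nu m k) ^+ Q k.

Lemma nu_powD N m Q P : nu_pow N m (Q + P)%MM = nu_pow N m Q * nu_pow N m P.
Proof.
by rewrite /nu_pow -big_split; apply: eq_bigr => k _; rewrite mnmDE exprD.
Qed.

Lemma nu_powU N m k : nu_pow N m U_(k)%MM = tr N (nu m k).
Proof.
rewrite /nu_pow (bigD1 k) //= mnm1E eqxx expr1 big1 ?mulr1 // => i hi.
by rewrite mnm1E eq_sym (negbTE hi) expr0.
Qed.

Lemma nu_pow_weighted N m Q : weighted mu (fun=> 1) (nu_pow N m Q).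
Proof.
apply: (@weighted_eq _ _ _ _ (fun m' => \prod_(k < n) 1 ^+ Q k)).
  by move=> m'; rewrite big1 // => k _; rewrite expr1n.
apply: (@weighted_prod _ _ _ _ _ _ (fun k _ => 1 ^+ Q k)) => k.
by apply: weightedX; apply: weighted_diag_invariant.
Qed.

Lemma nu_pow0 N m Q : (nu_pow N m Q)@_0%MM = mu_pow mu m Q.
Proof.
have /(_ 0%MM) := @trunc_mpow _ _ N (nu m) Q; rewrite mcoeff_trunc mdeg0 /= => <- //.
by rewrite series_mpow0; apply: eq_bigr => k _; rewrite nu0.
Qed.

(** Condition (ii) compares a power with some [nu_i], not with 1. For [A] nonzero it is applied to
    [A + U_(i)], which is resonant for [i] and has degree at least two; the unit [nu_i] is then
    cancelled. *)
Lemma nu_pow_invariant N m A : (forall m', mu_pow mu m' A = 1) ->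
  eqdeg N (nu_pow N m A) 1.
Proof.
move=> hA; have [->|A0] := eqVneq A 0%MM.
  by rewrite /nu_pow big1 // => k _; rewrite mnm0E expr0.
have [i eA] := mnm_split A0.
have res : resonant mu i (A + U_(i))%MM.
  by apply/resonantP => m'; rewrite mu_powD hA mul1r mu_powU.
have deg : (1 < mdeg (A + U_(i)))%N.
  by rewrite mdegD mdeg1 addn1 ltnS lt0n mdeg_eq0.
have e : eqdeg N (tr N (nu m i)) (nu_pow N m A * tr N (nu m i)).
  rewrite -[X in _ * X]nu_powU -nu_powD -{1}(nu_integrable deg res m).
  exact: trunc_mpow.
apply/eqdegP; apply: (@vanishing_cancel _ _ (tr N (nu m i))).
  by rewrite mcoeff_trunc mdeg0 /= nu0.
by rewrite mulrBl mul1r; apply/eqdegP; apply: eqdeg_sym.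
Qed.

(** Exponents are grouped by the series [nu_m^Q] rather than by the numbers [mu_m^Q], so that one
    series can be factored out of a whole class. *)
Definition same_class N Q P := forall m, eqdeg N (nu_pow N m Q) (nu_pow N m P).

Lemma same_class_mu N Q P : same_class N Q P ->
  forall m, mu_pow mu m Q = mu_pow mu m P.
Proof. by move=> h m; rewrite -!(nu_pow0 N) h // mdeg0. Qed.

Lemma same_class_add N Q A : (forall m, mu_pow mu m A = 1) ->
  same_class N (Q + A)%MM Q.
Proof.
move=> hA m; rewrite nu_powD -[X in eqdeg _ _ X]mulr1.
by apply: eqdegM => //; apply: nu_pow_invariant.
Qed.

Lemma same_class_sym N Q P : same_class N Q P -> same_class N P Q.
Proof. by move=> h m; apply: eqdeg_sym. Qed.

Lemma same_class_trans N Q P A :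
  same_class N Q P -> same_class N P A -> same_class N Q A.
Proof. by move=> h h' m; apply: eqdeg_trans (h m) (h' m). Qed.

(** Comparable exponents differ by some [A] with natural entries, and equality of their weights
    forces [mu_m^A = 1]. This is what the last clause of [poincare_type] is for. *)
Lemma same_class_comparable N Q P : (forall m, mu_pow mu m Q = mu_pow mu m P) ->
  (forall k, (P k <= Q k)%N) \/ (forall k, (Q k <= P k)%N) -> same_class N Q P.
Proof.
have pos m A : mu_pow mu m A != 0.
  by apply/prodf_neq0 => k _; rewrite expf_neq0.
have sub (B A : 'X_{1..n}) : (forall k, (B k <= A k)%N) ->
    (forall m, mu_pow mu m A = mu_pow mu m B) -> same_class N A B.
  move=> le e; have eA : A = (B + (A - B))%MM.
    by rewrite addmC submK //; apply/mnm_lepP.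
  rewrite [X in same_class _ X]eA; apply: same_class_add => m.
  by apply: (mulfI (pos m B)); rewrite mulr1 -mu_powD -eA.
by move=> e [h|h]; [apply: sub | apply: same_class_sym; apply: sub].
Qed.

(** [nu_m^Q'] contains only invariant monomials, so multiplying [z^P] by it stays in the class of
    [P]. *)
Lemma same_class_shift N m P Q Q' :
  (nu_pow N m Q' * 'X_[P])@_Q != 0 -> same_class N Q P.
Proof.
move=> /mcoeff_mulX_neq0[A -> hA]; apply: same_class_add => m'.
exact: (nu_pow_weighted hA).
Qed.

(* Multiplication by invariant monomials preserves the classes, so on a class
   the substitution of [hat (nu m)] is the multiplication by one series. *)
Lemma class_identity N m (w : R[i]) phi g Q0 Q' :
  (forall Q, (mdeg Q <= N)%N -> same_class N Q Q0 ->
    scomp phi (hat (nu m)) Q - w * phi Q = g Q) ->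
  same_class N Q' Q0 ->
  eqdeg N ((nu_pow N m Q' - w%:MP) * tr N (class_part (same_class N) Q0 phi))
    (tr N (class_part (same_class N) Q0 g)).
Proof.
move=> heq hQ' Q hQ; set E := same_class N.
have sub : scomp phi (hat (nu m)) Q =
    \sum_(P : 'X_{1..n < N.+1}) phi P * (nu_pow N m P * 'X_[P])@_Q.
  have /(_ Q hQ) := @trunc_comp _ _ N phi _ (@hat_fixes0 _ _ (nu m)).
  rewrite mcoeff_trunc hQ => ->.
  have /(_ Q hQ) -> : eqdeg N (subst (fun i => tr N (hat (nu m) i)) (tr N phi))
      (subst (fun k => tr N (nu m k) * 'X_k) (tr N phi)).
    by apply: eqdeg_subst_in => k; apply: trunc_hat.
  rewrite truncE subst_sum raddf_sum /=; apply: eq_bigr => P _.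
  rewrite substZ mcoeffZ substXm; congr (_ * _@_Q).
  under eq_bigr do rewrite exprMn.
  by rewrite big_split /= -[X in _ * X]substXm subst_id.
rewrite mulrBl mul_mpolyC mcoeffB mcoeffZ !mcoeff_trunc hQ.
have -> : (nu_pow N m Q' * tr N (class_part E Q0 phi))@_Q =
    if `[< E Q Q0 >] then scomp phi (hat (nu m)) Q else 0.
  rewrite truncE mulr_sumr raddf_sum /=.
  (* Inside the class [nu_m^P] may be replaced by [nu_m^Q']; a [z^P] from another class contributes
     nothing to [z^Q]. *)
  rewrite sub; case: ifPn => [/asboolP hE|/asboolPn hE].
    apply: eq_bigr => P _; rewrite -scalerAr mcoeffZ /class_part.
    case: asboolP => [hP|hP]; last first.
      rewrite mul0r; have [->|] := eqVneq ((nu_pow N m P * 'X_[P])@_Q) 0.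
        by rewrite mulr0.
      move=> /same_class_shift hs; case: hP.
      exact: same_class_trans (same_class_sym hs) hE.
    congr (_ * _); apply: eqdegM (hQ) => //.
    exact: same_class_trans hQ' (same_class_sym hP) m.
  apply: big1 => P _; rewrite -scalerAr mcoeffZ /class_part.
  case: asboolP => [hP|_]; last by rewrite mul0r.
  have [->|] := eqVneq ((nu_pow N m Q' * 'X_[P])@_Q) 0; first by rewrite mulr0.
  by move=> /same_class_shift hs; case: hE; apply: same_class_trans hs hP.
rewrite /class_part; case: asboolP => [hE|_]; first exact: heq.
by rewrite mulr0 subrr.
Qed.

End Classes.

(** * Convergence of a conjugacy without resonant monomials *)

Section NormalizedConvergence.
Context (R : realType) (n l : nat) (mu : 'M[R[i]]_(l, n)).
Context (F : 'I_l -> smap R n) (Phi Psi : smap R n) (nu : 'I_l -> 'I_n -> series R n).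
Hypotheses (mu_neq0 : forall m j, mu m j != 0)
  (F_conv : forall m j, convergent (F m j))
  (F_lin : forall m j Q, (mdeg Q < 2)%N -> F m j Q = mu m j * series_var R j Q)
  (Phi_tan : tangent_to_id Phi) (Psi0 : fixes0 Psi)
  (PhiK : cmap Phi Psi = @smap_id R n)
  (F_conj : conjugated Phi F nu)
  (nu0 : forall m j, nu m j 0%MM = mu m j)
  (nu_invariant : forall m j, diag_invariant mu (nu m j))
  (nu_integrable : integrable mu nu)
  (Phi_normal : forall j Q, resonant mu j Q -> Phi j Q = series_var R j Q)
  (mu_poincare : poincare_type mu).
Implicit Types (r : R) (Q P A : 'X_{1..n}).

Let f m j := ssub (F m j) (diag_smap (row m mu) j).
Let g m j := scomp (f m j) Phi.
Let phi j := ssub (Phi j) (series_var R j).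

Let Phi0 : fixes0 Phi. Proof. by case: Phi_tan. Qed.

Lemma f_order2 m j Q : (mdeg Q < 2)%N -> f m j Q = 0.
Proof. by move=> hQ; rewrite /f ssubE F_lin // /diag_smap mxE subrr. Qed.

Lemma phi_order2 j Q : (mdeg Q < 2)%N -> phi j Q = 0.
Proof.
by move=> hQ; rewrite /phi ssubE; move/tangentP: Phi_tan => -> //; rewrite subrr.
Qed.

Lemma var_resonant j Q : ~~ resonant mu j Q -> series_var R j Q = 0.
Proof.
by rewrite /series_var; have [->|//] := eqVneq Q U_(j)%MM; rewrite resonantU.
Qed.

Lemma hat_coef m j Q N : (mdeg Q <= N)%N ->
  hat (nu m) j Q = (tr N (nu m j) * 'X_j)@_Q.
Proof.
by move=> hQ; have := trunc_hat (nu m) j hQ; rewrite mcoeff_trunc hQ.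
Qed.

Lemma hat_equivariant m : equivariant mu (hat (nu m)).
Proof.
move=> j Q; rewrite (hat_coef _ _ (leqnn _)) => /mcoeff_mulX_neq0[A -> hA].
apply/resonantP => m'; rewrite mu_powD mu_powU.
by rewrite (weighted_diag_invariant (@nu_invariant m j) hA) mulr1.
Qed.

(** This is [F_m o Phi = Phi o hat (nu m)] with [F_m = D_m + f_m] and, on the right,
    [Phi = id + phi]. *)
Lemma conjugacy_coef m j Q : scomp (phi j) (hat (nu m)) Q + hat (nu m) j Q =
  g m j Q + mu m j * Phi j Q.
Proof.
have e : scomp (F m j) Phi = scomp (Phi j) (hat (nu m)).
  by rewrite -!cmapE F_conj.
rewrite /g /f /phi !scompB //; last exact: hat_fixes0.
rewrite !ssubE series_var_comp; last exact: hat_fixes0.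
by rewrite subrK e -[scomp (diag_smap _ _) _]cmapE diag_comp // mxE subrK.
Qed.

(** Substituting the equivariant [hat (nu m)] preserves weights and [phi] has no resonant monomial,
    so [phi o hat (nu m)] has none either. *)
Lemma resonant_coef m j Q : resonant mu j Q ->
  hat (nu m) j Q - mu m j * series_var R j Q = g m j Q.
Proof.
move=> rQ; have := conjugacy_coef m j Q; rewrite (Phi_normal rQ).
have -> : scomp (phi j) (hat (nu m)) Q = 0.
  apply/eqP; apply: contraT => h.
  have [P hP eP] := weights_comp (@hat_fixes0 _ _ _) (@hat_equivariant m) h.
  move: hP; rewrite /phi ssubE Phi_normal ?subrr ?eqxx //.
  by apply/resonantP => m'; rewrite -eP; move/resonantP: rQ.
by rewrite add0r => ->; rewrite addrK.
Qed.

Lemma nonresonant_coef m j Q : ~~ resonant mu j Q ->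
  scomp (phi j) (hat (nu m)) Q - mu m j * phi j Q = g m j Q.
Proof.
move=> rQ; have := conjugacy_coef m j Q.
have -> : hat (nu m) j Q = 0.
  by apply/eqP; apply: contraT => /hat_equivariant; rewrite (negbTE rQ).
by rewrite addr0 => ->; rewrite /phi ssubE var_resonant // subr0 addrK.
Qed.

Lemma eqdegM_vanishing N (p q a : {mpoly R[i][n]}) :
  eqdeg N p q -> vanishing 1 a -> eqdeg N.+1 (p * a) (q * a).
Proof.
move=> /eqdegP e va; apply/eqdegP; rewrite -mulrBl -[N.+2]addn1.
exact: vanishingM.
Qed.

(** [(nu_mj - mu_mj) z_j] agrees with [g m j] on resonant monomials and vanishes on the others; the
    factor [z_j] accounts for the extra degree and for the factor [r]. *)
Lemma nu_bound r N m j : 0 <= r ->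
  wnorm r N (tr N (nu m j) - (mu m j)%:MP) * r <= wnorm r N.+1 (tr N.+1 (g m j)).
Proof.
move=> r0; rewrite -(wnorm_mulX _ _ _ j); apply: ler_sum => -[Q hQ] _ /=.
rewrite ler_wpM2r ?exprn_ge0 // mcoeff_trunc; have hQ' := hQ; rewrite ltnS in hQ'.
rewrite hQ' mulrBl mul_mpolyC mcoeffB mcoeffZ.
have vX : vanishing 1 ('X_j : {mpoly R[i][n]}).
  by rewrite -(mdeg1 j); apply: vanishing_mon.
have /(_ Q hQ') <- := eqdegM_vanishing (@trunc_eqdeg _ _ N N.+1 (nu m j) (leqnSn _)) vX.
rewrite -(hat_coef _ _ hQ').
have -> : ('X_j : {mpoly R[i][n]})@_Q = series_var R j Q.
  by rewrite mcoeffX eq_sym.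
have [rQ|rQ] := boolP (resonant mu j Q); first by rewrite resonant_coef.
have -> : hat (nu m) j Q = 0.
  by apply/eqP; apply: contraT => /hat_equivariant; rewrite (negbTE rQ).
by rewrite var_resonant // mulr0 subrr normc0 normc_ge0.
Qed.

(** Control of [nu] up to degree [N] bounds [phi] up to degree [N + 1], with [eps] and [C]
    independent of [r] and [N]: [r] can thus be chosen after them. *)
Lemma phi_bound : exists eps C, [/\ 0 < eps, 0 < C & forall r N j, 0 <= r ->
  (forall m k, wnorm r N (tr N (nu m k) - (mu m k)%:MP) <= eps) ->
  wnorm r N.+1 (tr N.+1 (phi j)) <= C * \sum_m wnorm r N.+1 (tr N.+1 (g m j))].
Proof.
have [d [c [d1 c0 hdc]]] := mu_poincare.
have [eps [C [eps0 C0 hC]]] := divisor_bound mu_neq0 d1 c0.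
exists eps, C; split=> // r N j r0 hnu.
apply: (wnorm_class (E := same_class nu N.+1) _ _ _ r0 (ltW C0)) =>
  [Q m|Q P|Q P A|Q0 hQ0 nz].
- exact: eqdeg_refl.
- exact: same_class_sym.
- exact: same_class_trans.
have nres : ~~ resonant mu j Q0.
  by apply: contra nz => rQ; rewrite /phi ssubE Phi_normal // subrr.
have [|i [Q' [eQ' dQ' hmax hcomp]]] := hdc j Q0.
  move: nres; rewrite negb_forall => /existsP[m hm].
  by exists m; rewrite subr_eq0.
(* [Q'] serves only through its multiplier: it may have degree above [N + 1], and [z^Q'] may be
   absent from [phi j]. *)
have cl : same_class nu N.+1 Q' Q0.
  by apply: (same_class_comparable mu_neq0 nu0 (@nu_integrable) eQ').
exists i; set p := tr N.+1 (class_part _ Q0 (phi j)).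
apply: le_trans (hC i j Q' dQ' hmax r N.+1 (fun k => tr N (nu i k)) p r0 _) _.
  move=> k; rewrite wnorm_succ // => Q hQ.
  rewrite mcoeffB mcoeffC mcoeff_trunc leqNgt hQ /=.
  have /negbTE -> : Q != 0%MM by rewrite -mdeg_eq0 -lt0n (leq_ltn_trans _ hQ).
  by rewrite mulr0 subrr.
rewrite ler_wpM2l ?(ltW C0) //.
have p1 : vanishing 1 p.
  apply: vanishing1_trunc; rewrite /class_part phi_order2 ?mdeg0 //.
  by rewrite if_same.
(* [p] has no constant term, so truncating [nu] at degree [N] instead of [N + 1] changes the product
   only above degree [N + 1]. *)
have e : eqdeg N.+1 ((\prod_(k < n) tr N (nu i k) ^+ Q' k - (mu i j)%:MP) * p)
    ((nu_pow nu N.+1 i Q' - (mu i j)%:MP) * p).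
  apply: eqdegM_vanishing p1; apply: eqdegB; last exact: eqdeg_refl.
  by apply: eqdeg_prod => k _; apply: eqdegX; apply: eqdeg_sym; apply: trunc_eqdeg.
have id := class_identity mu_neq0 nu0 (@nu_invariant) (@nu_integrable) (m := i) (w := mu i j)
  (phi := phi j) (g := g i j) _ cl.
rewrite (wnorm_eqdeg _ (eqdeg_trans e (id _))) // => Q hQ hcl.
apply: nonresonant_coef; apply: contra nres => /resonantP rQ.
by apply/resonantP => m; rewrite -(same_class_mu nu0 hcl).
Qed.

Lemma normalized_bound : exists r B, [/\ 0 < r,
  forall j N, wnorm r N (tr N (phi j)) <= r &
  forall m j N, wnorm r N (tr N (nu m j) - (mu m j)%:MP) <= B].
Proof.
have [r0 [M [r0_gt0 M0 hF]]] := common_radius (fun t => F_conv t.1 t.2).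
have [Mu [Mu1 hMu]] := finite_bound (fun t : 'I_l * 'I_n => normc (mu t.1 t.2)).
have [eps [C [eps0 C0 hphi]]] := phi_bound.
pose M' := M + Mu * r0.
have M'0 : 0 <= M' by rewrite addr_ge0 // mulr_ge0 //; lra.
have hf m j N : wnorm r0 N (tr N (f m j)) <= M'.
  rewrite /f truncB; apply: le_trans (wnormB _ _ _ (ltW r0_gt0)) _.
  apply: lerD; first exact: (hF (m, j)).
  rewrite /diag_smap truncZ wnormZ mxE; apply: ler_pM.
  - exact: normc_ge0.
  - exact: wnorm_ge0 (ltW r0_gt0).
  - exact: (hMu (m, j)).
  - exact: wnorm_trunc_var (ltW r0_gt0).
(* Chosen so that [K * r ^+ 2] is [(2 * r / r0) ^+ 2 * M'], the bound on [g] for order two and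
   doubled radius. *)
pose K := 4 * M' / r0 ^+ 2.
have K0 : 0 <= K by rewrite divr_ge0 ?exprn_ge0 ?mulr_ge0 //; lra.
have L0 : 0 <= C * l%:R * K by rewrite mulr_ge0 // mulr_ge0 ?ler0n ?(ltW C0).
(* The three conditions keep the doubled radius within [r0], keep [nu - mu] below [eps], and close
   the induction on [phi]. In the witness, adding 1 to [K] and [L] covers the case where they are
   zero. *)
have [r [r_gt0 r1 r2 r3]] : exists r, [/\ 0 < r, r <= r0 / 2, K * r <= eps &
    C * l%:R * K * r <= 1].
  move: K0 L0; move: K => K K0; move: (C * l%:R * K) => L L0.
  exists (Num.min (r0 / 2) (Num.min (eps / (K + 1)) (L + 1)^-1)).
  set r := Num.min _ _.
  have r2 : r <= eps / (K + 1) by rewrite !ge_min lexx !orbT.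
  have r3 : r <= (L + 1)^-1 by rewrite !ge_min lexx !orbT.
  have r_gt0 : 0 < r by rewrite !lt_min !divr_gt0 ?invr_gt0 //; lra.
  split=> //; first by rewrite ge_min lexx.
    by move: r2; rewrite ler_pdivlMr; [nra | lra].
  by move: r3; rewrite -div1r ler_pdivlMr; [nra | lra].
have rge : 0 <= r by apply: ltW.
have hg N m j : (forall i, wnorm r N (tr N (phi i)) <= r) ->
    wnorm r N.+1 (tr N.+1 (g m j)) <= K * r * r.
  move=> h; apply: le_trans (wnorm_comp rge (@f_order2 m j) Phi0 h) _.
  have h1 : 0 <= 2 * r by lra.
  have h2 : 2 * r <= r0 by lra.
  have hv : vanishing 2 (tr N.+1 (f m j)).
    by move=> Q hQ; rewrite mcoeff_trunc f_order2 // if_same.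
  apply: le_trans (wnorm_order2 N.+1 r0_gt0 h1 h2 hv) _.
  apply: (@le_trans _ _ ((2 * r / r0) ^+ 2 * M')).
    by rewrite ler_wpM2l ?sqr_ge0.
  rewrite le_eqVlt; apply/orP; left; apply/eqP; rewrite /K; field.
  by rewrite gt_eqF.
have hnu N m j : (forall i, wnorm r N (tr N (phi i)) <= r) ->
    wnorm r N (tr N (nu m j) - (mu m j)%:MP) <= eps.
  move=> h; apply: le_trans r2; rewrite -(ler_pM2r r_gt0).
  exact: le_trans (nu_bound N m j rge) (hg N m j h).
(* The bound on [phi] up to degree [N] controls [nu] up to degree [N] and [g] up to degree [N + 1],
   and these two control [phi] up to degree [N + 1]. *)
have main N j : wnorm r N (tr N (phi j)) <= r.
  elim: N j => [|N ih] j.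
    rewrite wnorm_vanishing // => Q hQ.
    by rewrite mcoeff_trunc phi_order2 ?if_same // ltnW.
  apply: le_trans (hphi r N j rge (fun m k => hnu N m k ih)) _.
  apply: (@le_trans _ _ (C * (l%:R * (K * r * r)))).
    rewrite ler_wpM2l ?(ltW C0) //.
    rewrite -[l in l%:R]card_ord mulr_natl -sumr_const.
    by apply: ler_sum => m _; apply: hg.
  have -> : C * (l%:R * (K * r * r)) = C * l%:R * K * r * r by ring.
  by rewrite -[leRHS]mul1r ler_wpM2r.
exists r, eps; split=> // m j N; apply: hnu => i; exact: main.
Qed.

Lemma normalized_convergent :
  [/\ forall j, convergent (Phi j), forall j, convergent (Psi j) &
      forall m j, convergent (nu m j)].
Proof.
have [r [B [r0 hphi hnu]]] := normalized_bound.
split=> [j|j|m j].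
- apply: (@wnorm_convergent _ _ _ r (r + r)) => // N.
  rewrite -(subrK (tr N (series_var R j)) (tr N (Phi j))) -truncB.
  apply: le_trans (wnormD _ _ _ (ltW r0)) _; apply: lerD; first exact: hphi.
  exact: wnorm_trunc_var (ltW r0).
- have hPsi i Q : Psi i Q = series_var R i Q - scomp (phi i) Psi Q.
    rewrite /phi scompB // series_var_comp // -cmapE PhiK ssubE.
    by rewrite opprB addrC subrK.
  have [s s0 hs] := inverse_bound r0 (ltW r0) Psi0 phi_order2 hphi hPsi.
  apply: (@wnorm_convergent _ _ _ s (s + s)) => // N.
  rewrite -(subrK (tr N (series_var R j)) (tr N (Psi j))) -truncB.
  apply: le_trans (wnormD _ _ _ (ltW s0)) _; apply: lerD; first exact: hs.
  exact: wnorm_trunc_var (ltW s0).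
- apply: (@wnorm_convergent _ _ _ r (B + normc (mu m j))) => // N.
  rewrite -(subrK (mu m j)%:MP (tr N (nu m j))).
  apply: le_trans (wnormD _ _ _ (ltW r0)) _; rewrite wnormC lerD2r.
  exact: hnu.
Qed.

End NormalizedConvergence.

(** * Return to the unlocked operations, and the theorem *)

Section Unlocking.
Context (R : realType) (n : nat).

Lemma smap_compE (F G : smap R n) : smap_comp F G = cmap F G.
Proof. by rewrite /cmap /scomp locked_withE. Qed.

Lemma series_compE (f : series R n) G : series_comp f G = scomp f G.
Proof. by rewrite /scomp locked_withE. Qed.

Lemma series_mulE (f g : series R n) : series_mul f g = smul f g.
Proof. by rewrite /smul locked_withE. Qed.

Lemma series_mpowE (G : 'I_n -> series R n) Q : series_mpow G Q = smpow G Q.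
Proof. by rewrite /smpow locked_withE. Qed.

End Unlocking.

Theorem theorem1p6 (R : realType) (n l : nat) (mu : 'M[R[i]]_(l, n))
    (F : 'I_l -> smap R n)
    (mu_neq0 : forall m j, mu m j != 0)
    (F_biholo : forall m, biholomorphic_germ (F m))
    (F_linear : forall m, linear_part (F m) = diag_mx (row m mu))
    (F_formal : formally_completely_integrable mu F)
    (D_poincare : poincare_type mu) :
  holomorphically_completely_integrable mu F /\
  exists G : 'I_l -> smap R n,
    holomorphically_equivalent F G /\
    forall m k : 'I_l,
      smap_comp (G m) (diag_smap (row k mu)) =
      smap_comp (diag_smap (row k mu)) (G m).
Proof.
have F0 m : fixes0 (F m) by have [G [[]]] := F_biholo m.
have F_conv m j : convergent (F m j) by have [G [_ /(_ j)[]]] := F_biholo m.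
have F_lin m j Q : (mdeg Q < 2)%N -> F m j Q = mu m j * series_var R j Q.
  case e: (mdeg Q) => [|[|//]] _.
    by move/eqP: e; rewrite mdeg_eq0 => /eqP ->; rewrite F0 series_var0 mulr0.
  move/eqP: e => /mdeg1P[k /eqP ->]; have /matrixP/(_ j k) := F_linear m.
  rewrite !mxE => ->.
  by rewrite /series_var eq_mnm1 [k == j]eq_sym mulr_natr.
have [Phi [Psi [nu [[[[_ Psi0] _ e1 e2] tP] conj cnu inv int]]]] := F_formal.
rewrite !smap_compE in e1 e2.
have nu0 m j : nu m j 0%MM = mu m j by case: (cnu m j).
have nuI m j : diag_invariant mu (nu m j).
  by apply/diag_invariantP => k; rewrite -series_compE; apply: inv.
have mpow0 (nu' : 'I_l -> 'I_n -> series R n) m Q :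
    (forall m j, nu' m j 0%MM = mu m j) -> smpow (nu' m) Q 0%MM = mu_pow mu m Q.
  by move=> h; rewrite series_mpow0; apply: eq_bigr => k _; rewrite h.
have inu : integrable mu nu.
  move=> j Q hQ /resonantP rQ m; rewrite -series_mpowE; move: m.
  by apply/(int j Q hQ) => m; rewrite series_mpowE mpow0 // nu0.
have [P0 _] := tP.
have F_conj : conjugated Phi F nu.
  move=> m; have : cmap Psi (cmap (F m) Phi) = hat (nu m).
    apply: funext => j; rewrite /hat -!smap_compE -series_mulE; exact: conj.
  move=> <-; rewrite -smap_compA //; last exact: fixes0_comp.
  by rewrite e1 smap_id_comp //; apply: fixes0_comp.
have [Phi' [Psi' [nu' [[tP' Psi'0 e1' e2'] F_conj' [nu'0 nu'I inu'] norm]]]] :=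
  normalization tP Psi0 e1 e2 F_conj nu0 (@nuI) (@inu).
have [P'0 _] := tP'.
have [cP cPs cn] := normalized_convergent mu_neq0 F_conv F_lin tP' Psi'0 e1'
  F_conj' nu'0 (@nu'I) (@inu') norm D_poincare.
have bihol : biholomorphic_pair (@convergent R n) Phi' Psi'.
  by split=> //; rewrite smap_compE.
have hatE m : conjugate Phi' Psi' (F m) = hat (nu' m).
  rewrite /conjugate !smap_compE F_conj' -smap_compA //; last exact: hat_fixes0.
  by rewrite e2' smap_id_comp //; apply: hat_fixes0.
split.
  exists Phi', Psi', nu'; split=> //.
  - by move=> m j; rewrite hatE /hat series_mulE.
  - by move=> m k j; rewrite series_compE; move: k; apply/diag_invariantP.
  - move=> j Q hQ; split=> h m; last by rewrite h.
    rewrite series_mpowE; apply: inu' => //; apply/resonantP => k.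
    by rewrite -(mpow0 nu') // -series_mpowE h nu'0.
exists (fun m => hat (nu' m)); split.
  by exists Phi', Psi'; split.
move=> m k; rewrite !smap_compE; move: k.
apply/equivariantP; first exact: hat_fixes0.
exact: hat_equivariant.
Qed.
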